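(* Let $I$ be a non-empty open interval of $\mathbb{R}$ and let $\gamma$ be a finite measure on $\mathcal{B}_I$ of finite first moment. Let $a\in[0,\gamma(I)]$ and $b\in\big[\int y\,\gamma_0^a(dy),\int y\,\gamma_{\gamma(I)-a}^{\gamma(I)}(dy)\big]$. Let $\mathcal{N}$ be the collection of all measures $\mu$ on $\mathcal{B}_I$ with $\mu(I)=a$, $\int y\,\mu(dy)=b$ and $\mu\le\gamma$. Let $\phi:I\to\mathbb{R}$ be concave with $\int\phi^-\,d\gamma<\infty$. Then: (i) the supremum $\sup_{\mu\in\mathcal{N}}\int\phi\,d\mu$ is attained at the unique connected part of $\gamma$ that belongs to $\mathcal{N}$; (ii) the infimum $\inf_{\mu\in\mathcal{N}}\int\phi\,d\mu$ is attained at the unique co-connected part of $\gamma$ that belongs to $\mathcal{N}$. If $\phi$ is strictly concave, then the supremum in (i) and the infimum in (ii) are uniquely attained.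
   Context: $\mathcal{B}_I$ denotes the Borel $\sigma$-field of $I$. For measures, $\mu\le\gamma$ means $\mu(B)\le\gamma(B)$ for all $B\in\mathcal{B}_I$. For a finite measure $\gamma$ on $\mathcal{B}_I$ and reals $0\le a\le b\le\gamma(I)$, $\gamma_a^b$ is the unique measure $\rho$ on $\mathcal{B}_I$ with $\rho((-\infty,x]\cap I)=(\gamma((-\infty,x]\cap I)-a)^+\wedge(b-a)$ for all $x\in I$ (the restriction of $\gamma$ between the quantiles $a$ and $b$). A measure is called a connected part of $\gamma$ if it equals $\gamma_a^b$, and a co-connected part of $\gamma$ if it equals $\gamma-\gamma_a^b$, for some $0\le a\le b\le\gamma(I)$. For $a,b$ as in the claim there is a unique connected part, and a unique co-connected part, of $\gamma$ of mass $a$ and first moment $b$. *)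

(* Defs.v *)
From HB Require Import structures.
From mathcomp Require Import all_boot all_order all_algebra.
From mathcomp Require Import all_classical all_reals all_analysis.

Set Implicit Arguments.
Unset Strict Implicit.
Unset Printing Implicit Defensive.

Import Order.TTheory GRing.Theory Num.Theory.
Import numFieldNormedType.Exports.

Local Open Scope classical_set_scope.
Local Open Scope ring_scope.

(* A measure on the Borel sigma-field of I (a Borel set) is encoded as a Borel
   measure on the real line that gives mass zero to the complement of I;
   extension by zero and restriction are mutually inverse.  A library measure
   is a function on all sets whose values off the measurable sets are
   irrelevant, so equality of measures is [measure_eq], not Leibniz equality. *)

Definition borel_measure (R : realType) : Type :=
  {measure set (measurableTypeR R) -> \bar R}.

Definition concentrated (R : realType) (I : set R)
    (mu : set (measurableTypeR R) -> \bar R) : Prop :=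
  mu (~` I) = 0%E.

Definition measure_eq (R : realType)
    (mu nu : set (measurableTypeR R) -> \bar R) : Prop :=
  forall B : set (measurableTypeR R), measurable B -> mu B = nu B.

Definition measure_le (R : realType)
    (mu nu : set (measurableTypeR R) -> \bar R) : Prop :=
  forall B : set (measurableTypeR R), measurable B -> (mu B <= nu B)%E.

Definition is_quantile_restriction (R : realType) (I : set R)
    (gamma : set (measurableTypeR R) -> \bar R) (a b : R)
    (rho : set (measurableTypeR R) -> \bar R) : Prop :=
  concentrated I rho /\
  forall x : R, I x ->
    rho ([set y | y <= x] `&` I) =
    (mine (maxe (gamma ([set y | (y <= x)%R] `&` I) - a%:E) 0) (b - a)%:E)%E.

(* gamma_a^b, by definite description; the zero measure is a junk value, never
   reached when gamma is finite on I and 0 <= a <= b <= gamma I. *)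
Definition quantile_restriction (R : realType) (I : set R)
    (gamma : set (measurableTypeR R) -> \bar R) (a b : R) : borel_measure R :=
  @xget {classic borel_measure R} (mzero : borel_measure R)
    [set rho : borel_measure R | is_quantile_restriction I gamma a b rho].

Definition connected_part (R : realType) (I : set R)
    (gamma mu : set (measurableTypeR R) -> \bar R) : Prop :=
  exists s t : R, [/\ 0 <= s, s <= t, (t%:E <= gamma I)%E &
    measure_eq mu (quantile_restriction I gamma s t)].

Definition coconnected_part (R : realType) (I : set R)
    (gamma mu : set (measurableTypeR R) -> \bar R) : Prop :=
  exists s t : R, [/\ 0 <= s, s <= t, (t%:E <= gamma I)%E &
    measure_eq mu (fun B => gamma B - quantile_restriction I gamma s t B)%E].

Definition first_moment (R : realType) (I : set R)
    (mu : set (measurableTypeR R) -> \bar R) : \bar R :=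
  (\int[mu]_(y in (I : set (measurableTypeR R))) (y%:E))%E.

Definition submeasures (R : realType) (I : set R)
    (gamma : set (measurableTypeR R) -> \bar R) (a b : R) :
    set (borel_measure R) :=
  [set mu | [/\ concentrated I mu, mu I = a%:E, first_moment I mu = b%:E &
                measure_le mu gamma]].

Definition unique_measure (R : realType) (P : set (borel_measure R))
    (mu : borel_measure R) : Prop :=
  P mu /\ forall nu : borel_measure R, P nu -> measure_eq nu mu.

Definition concave_function (R : realType) (D : set R) (f : R -> R) : Prop :=
  convex_function (E := R^o) D (\- f).

Definition strictly_concave_function (R : realType) (D : set R) (f : R -> R) :
    Prop :=
  forall x y t : R, D x -> D y -> x != y -> 0 < t -> t < 1 ->
    t * f x + (1 - t) * f y < f (t * x + (1 - t) * y).

(* Main.v *)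
(** By Radon-Nikodym a measure [mu <= gamma] is [g gamma] with a density
    [0 <= g <= 1], so that [N] becomes the set of such [g] with prescribed
    integrals of [g] and [y g].  The measure [gamma_0^t] has a nonincreasing
    density [k_t] which is 1 to the left of a quantile [q_t] and 0 to its right,
    and the connected part [gamma_s^t] has the density [c = k_t - k_s], which is
    1 between [p = q_s] and [q = q_t] and 0 outside.  Let [l] be the affine
    function that agrees with [phi] at [p] and [q] (a supporting line when
    [p = q]).  Then [phi - l] and [c - g] have the same sign everywhere, so the
    integral of [(phi - l) (c - g)] is nonnegative; it equals the integral of
    [phi (c - g)], since [c] and [g] have the same mass and moment.  If
    [phi] is strictly concave and equality holds, then [c - g] vanishes off
    [{p, q}], and mass and moment force [c = g] almost everywhere.

    A connected part with the prescribed mass and moment exists by the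
    intermediate value theorem, and it is unique because two of them would both
    be maximizers for the strictly concave function [y |-> - sqrt (1 + y^2)].
    The involution [g |-> 1 - g] exchanges connected and co-connected parts and
    turns (ii) into (i). *)

Require Import Defs.
From HB Require Import structures.
From mathcomp Require Import all_boot all_order all_algebra.
From mathcomp Require Import all_classical all_reals all_analysis.
From mathcomp Require Import measurable_realfun.
From mathcomp Require Import ring lra.

Set Implicit Arguments.
Unset Strict Implicit.
Unset Printing Implicit Defensive.

Import Order.TTheory GRing.Theory Num.Theory.
Import numFieldNormedType.Exports.

Local Open Scope classical_set_scope.
Local Open Scope ring_scope.

(** * Submeasures as densities *)

Section densities.
Context d (T : measurableType d) (R : realType).
Variable gamma : {finite_measure set T -> \bar R}.
Variable I : set T.
Hypothesis mI : measurable I.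

(** The bounds hold everywhere and not only almost everywhere, so that sign arguments and the
    complement [1 - g] are pointwise. *)
Definition unit_fun (g : T -> R) :=
  measurable_fun setT g /\ forall x, 0 <= g x <= 1.

(** Integrating over the part of [B] in [I] makes every measure with a density vanish off [I],
    whatever [g] is there. *)
Definition has_density (mu : set T -> \bar R) (g : T -> R) :=
  forall B : set T, measurable B ->
    mu B = (\int[gamma]_(x in B `&` I) (g x)%:E)%E.

Lemma unit_fun_integrable g (D : set T) :
  measurable D -> unit_fun g -> gamma.-integrable D (EFin \o g).
Proof.
move=> mD [mg g01].
apply: measurable_bounded_integrable => //.
- by rewrite -ge0_fin_numE// fin_num_measure.
- exact: measurable_funTS.
- exists 1; split => // z z1 x _.
  have /andP[g0 g1] := g01 x; rewrite /=.
  by rewrite ger0_norm// (le_trans g1)// ltW.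
Qed.

Lemma integrableM_unit f g : unit_fun g ->
  gamma.-integrable I (EFin \o f) ->
  gamma.-integrable I (EFin \o (fun x => f x * g x)).
Proof.
move=> [mg g01] intf; apply: (le_integrable mI _ _ intf).
  apply/measurable_EFinP/measurable_funM.
    exact/measurable_EFinP/(measurable_int gamma intf).
  exact: measurable_funTS.
move=> x _ /=; rewrite lee_fin normrM ler_piMr//.
by have /andP[g0 g1] := g01 x; rewrite ger0_norm.
Qed.

Lemma density_le mu g : unit_fun g -> has_density mu g ->
  forall B : set T, measurable B -> (mu B <= gamma B)%E.
Proof.
move=> ug mug B mB; rewrite mug//.
have mBI : measurable (B `&` I) by exact: measurableI.
apply: (@le_trans _ _ (\int[gamma]_(x in B `&` I) 1)%E).
  apply: ge0_le_integral => //.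
  - by move=> x _; rewrite lee_fin; have /andP[] := ug.2 x.
  - exact: (measurable_int gamma (unit_fun_integrable mBI ug)).
  - by move=> x _; rewrite lee_fin; have /andP[] := ug.2 x.
rewrite integral_cst// mul1e; by apply: le_measure; rewrite ?inE.
Qed.

Lemma exists_density_measure g : unit_fun g ->
  exists mu : {measure set T -> \bar R}, has_density mu g.
Proof.
move=> ug.
pose m (B : set T) := (\int[gamma]_(x in B) (g x * \1_I x)%:E)%E.
have mg : measurable_fun setT (fun x => (g x * \1_I x)%:E).
  apply/measurable_EFinP/measurable_funM; [exact: ug.1 | exact: measurable_indic].
have g0 x : (0 <= (g x * \1_I x)%:E)%E.
  by rewrite lee_fin mulr_ge0//; have /andP[] := ug.2 x.
have m0 : m set0 = 0%E by rewrite /m integral_set0.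
have mge0 B : (0 <= m B)%E by exact: integral_ge0.
have madd : semi_sigma_additive m by exact: semi_sigma_additive_nng_induced.
pose mu : {measure set T -> \bar R} :=
  HB.pack m (isMeasure.Build _ _ _ m m0 mge0 madd).
exists mu => B mB; rewrite /= /m integral_mkcondr; apply: eq_integral => x _.
by rewrite /= patchE indicE; case: ifP; rewrite ?mulr1 ?mulr0.
Qed.

Lemma ae_eq_density mu nu g h : unit_fun g -> unit_fun h ->
  has_density mu g -> has_density nu h ->
  ae_eq gamma I (EFin \o g) (EFin \o h) <->
  forall B : set T, measurable B -> mu B = nu B.
Proof.
move=> ug uh mug nuh; split=> [gh B mB | mn].
  rewrite mug// nuh//; apply: ae_eq_integral.
  - exact: measurableI.
  - apply/measurable_EFinP/measurable_funTS; exact: ug.1.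
  - apply/measurable_EFinP/measurable_funTS; exact: uh.1.
  - apply: ae_eq_subset gh; exact: subIsetr.
apply: integral_ae_eq => //.
- exact: unit_fun_integrable.
- apply/measurable_EFinP/measurable_funTS; exact: uh.1.
- move=> E EI mE; have := mn E mE; rewrite mug// nuh//.
  by rewrite setIidl.
Qed.

Section measure_le.
Variable mu : {measure set T -> \bar R}.
Hypothesis mugamma : forall B : set T, measurable B -> (mu B <= gamma B)%E.

Let mufin : fin_num_fun mu.
Proof.
move=> B mB; rewrite ge0_fin_numE// (le_lt_trans (mugamma mB))//.
by rewrite -ge0_fin_numE// fin_num_measure.
Qed.

Let mu_sigma_finite : sigma_finite setT mu.
Proof. by apply: fin_num_fun_sigma_finite => //; rewrite measure0. Qed.

(** The same set function as [mu], repackaged with the finiteness that it inherits from [gamma], so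
    that Radon-Nikodym applies. *)
Definition finite_measure_of_le : {finite_measure set T -> \bar R} :=
  HB.pack_for (FiniteMeasure.type T R) (Measure.sort mu)
    (isFinite.Build _ _ _ _ mufin)
    (isSFinite.Build _ _ _ _ (sfinite_measure_sigma_finite mu_sigma_finite))
    (isSigmaFinite.Build _ _ _ _ mu_sigma_finite).

Lemma le_dominates : finite_measure_of_le `<< gamma.
Proof.
apply/null_content_dominatesP => A mA gA0.
by apply/eqP; rewrite eq_le measure_ge0 andbT -gA0 mugamma.
Qed.

End measure_le.

Lemma exists_density (mu : {measure set T -> \bar R}) : mu (~` I) = 0%E ->
  (forall B : set T, measurable B -> (mu B <= gamma B)%E) ->
  exists2 g, unit_fun g & has_density mu g.
Proof.
move=> muI mugamma.
pose nu := finite_measure_of_le mugamma.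
have numu : nu `<< gamma by exact: le_dominates.
pose f := Radon_Nikodym_SigmaFinite.f nu gamma.
have f0 x : (0 <= f x)%E by exact: Radon_Nikodym_SigmaFinite.f_ge0.
have fint : gamma.-integrable setT f.
  exact: Radon_Nikodym_SigmaFinite.f_integrable.
have fE (A : set T) : measurable A -> mu A = (\int[gamma]_(x in A) f x)%E.
  exact: (Radon_Nikodym_SigmaFinite.f_integral numu).
have mf := measurable_int gamma fint.
have ffin x : f x \is a fin_num by exact: Radon_Nikodym_SigmaFinite.f_fin_num.
(* The derivative is at most 1 only almost everywhere; truncation makes the bound pointwise. *)
pose g x := Num.min (fine (f x)) 1.
have ug : unit_fun g.
  split; last by move=> x; rewrite /g le_min ler01 ge_min lexx orbT fine_ge0.
  apply: measurable_minr => //.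
  exact: measurableT_comp mf.
exists g => // B mB.
have mBI : measurable (B `&` I) by exact: measurableI.
rewrite (measureDI mu mB mI) [X in (X + _)%E](_ : _ = 0%E) ?add0e; last first.
  apply: subset_measure0 muI; [exact: measurableD|exact: measurableC|].
  by rewrite setDE; exact: subIsetr.
apply: (eq_trans (fE _ mBI)); apply: ae_eq_integral => //.
- exact: measurable_funTS.
- apply/measurable_EFinP/measurable_funTS; exact: ug.1.
(* On a subset [E] of [A] the integral of [f] is [mu E <= gamma E], although [f > 1] there. Hence
   [f = 1] almost everywhere on [A], and the truncation changes [f] on a null set only. *)
pose A := [set x | (1 < f x)%E].
have mA : measurable A.
  by rewrite -[A]setTI; exact: emeasurable_fun_o_infty.
have fA1 : ae_eq gamma A f (cst 1%E).
  apply: integral_ae_eq => //; first exact: integrableS fint.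
  move=> E EA mE; apply/eqP; rewrite eq_le; apply/andP; split.
    by rewrite -fE// integral_cst// mul1e mugamma.
  apply: ge0_le_integral => //.
    exact: measurable_funTS.
  by move=> x /EA /ltW.
apply: filterS fA1 => x fA1 _; rewrite /g /= -[LHS]fineK//; congr EFin.
have [f1|f1] := leP (fine (f x)) 1 => //.
suff : f x = 1%E by move=> ->.
by apply: fA1; rewrite /A /= -[f x]fineK// lte_fin.
Qed.

(** Change of variables along the Radon-Nikodym derivative, which is [g] almost everywhere on [I],
    settles nonnegative functions. Positive and negative parts do the rest, since a factor [g >= 0]
    passes through the maximum with 0. *)
Lemma integral_density (mu : {measure set T -> \bar R}) g (f : T -> R) :
  unit_fun g -> has_density mu g -> measurable_fun I f ->
  (\int[mu]_(x in I) (f x)%:E = \int[gamma]_(x in I) (f x * g x)%:E)%E.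
Proof.
move=> ug mug mf.
have mugamma := density_le ug mug.
pose nu := finite_measure_of_le mugamma.
have numu : nu `<< gamma by exact: le_dominates.
pose r := Radon_Nikodym_SigmaFinite.f nu gamma.
have rE (A : set T) : measurable A -> mu A = (\int[gamma]_(x in A) r x)%E.
  exact: (Radon_Nikodym_SigmaFinite.f_integral numu).
have rint : gamma.-integrable setT r.
  exact: Radon_Nikodym_SigmaFinite.f_integrable.
have mg : measurable_fun I (EFin \o g).
  apply/measurable_EFinP/measurable_funTS; exact: ug.1.
have rg : ae_eq gamma I r (EFin \o g).
  apply: integral_ae_eq => //; first exact: integrableS rint.
  by move=> E EI mE; rewrite -rE// mug// setIidl.
have pos h : (forall x, (0 <= h x)%E) -> measurable_fun I h ->
    (\int[mu]_(x in I) h x = \int[gamma]_(x in I) (h x * (g x)%:E))%E.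
  move=> h0 mh.
  rewrite -(Radon_Nikodym_SigmaFinite.change_of_variables numu h0 mI mh).
  apply: ae_eq_integral => //.
  - apply: emeasurable_funM => //; apply: measurable_funTS.
    exact: (measurable_int gamma rint).
  - exact: emeasurable_funM.
  - by apply: filterS rg => x rg Ix; congr (_ * _)%E; exact: rg.
have mEf : measurable_fun I (EFin \o f) by exact/measurable_EFinP.
rewrite integralE [RHS]integralE !pos//; last 2 first.
- exact: measurable_funeneg.
- exact: measurable_funepos.
have g0 x : (0 <= g x)%R by have /andP[] := ug.2 x.
congr (_ - _)%E; apply: eq_integral => x _.
- by rewrite !funeposE EFinM maxe_pMl ?mul0e// lee_fin.
- by rewrite !funenegE EFinM -mulNe maxe_pMl ?mul0e// lee_fin.
Qed.

End densities.

(** * Linear combinations of real-valued integrable functions *)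

Section integrable_real.
Context d (T : measurableType d) (R : realType).
Variable gamma : {measure set T -> \bar R}.
Variable I : set T.
Hypothesis mI : measurable I.
Implicit Types f g : T -> R.

Lemma integrable_addr f g : gamma.-integrable I (EFin \o f) ->
  gamma.-integrable I (EFin \o g) ->
  gamma.-integrable I (EFin \o (fun x => f x + g x)).
Proof. by move=> intf intg; have := integrableD mI intf intg. Qed.

Lemma integrable_subr f g : gamma.-integrable I (EFin \o f) ->
  gamma.-integrable I (EFin \o g) ->
  gamma.-integrable I (EFin \o (fun x => f x - g x)).
Proof. by move=> intf intg; have := integrableB mI intf intg. Qed.

Lemma integrable_mulr c f : gamma.-integrable I (EFin \o f) ->
  gamma.-integrable I (EFin \o (fun x => c * f x)).
Proof. by move=> intf; have := integrableZl mI c intf. Qed.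

End integrable_real.

(** * Comparison of densities that cross twice *)

Section ae_rigidity.
Context d (T : measurableType d) (R : realType).
Variable gamma : {measure set T -> \bar R}.
Variable I : set T.
Hypothesis mI : measurable I.

Lemma Rintegral_ge0_ae0 (f : T -> R) : gamma.-integrable I (EFin \o f) ->
  {ae gamma, forall x, I x -> 0 <= f x} -> \int[gamma]_(x in I) f x = 0 ->
  ae_eq gamma I (EFin \o f) (cst 0%E).
Proof.
move=> intf f0 Ef0; have mf := measurable_int gamma intf.
apply/ae_eq_integral_abs => //.
transitivity (\int[gamma]_(x in I) (f x)%:E)%E.
  apply: ae_eq_integral => //; first exact: measurableT_comp.
  by apply: filterS f0 => x f0 /f0 fx0; rewrite /= ger0_norm.
have /fineK <- := integrable_fin_num mI intf.
by congr EFin.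
Qed.

(** Values in [{0, c}] all have the sign of [c], so nothing can cancel in the integral. *)
Lemma Rintegral_two_valued_ae0 (f : T -> R) c : gamma.-integrable I (EFin \o f) ->
  {ae gamma, forall x, I x -> f x = 0 \/ f x = c} ->
  \int[gamma]_(x in I) f x = 0 -> ae_eq gamma I (EFin \o f) (cst 0%E).
Proof.
move=> intf fc Ef0; have [c0|c0] := leP 0 c.
  apply: Rintegral_ge0_ae0 => //.
  by apply: filterS fc => x fc /fc [->|->].
have intNf : gamma.-integrable I (EFin \o (fun x => - 1 * f x)).
  exact: (integrable_mulr mI (-1) intf).
suff /filterS : ae_eq gamma I (EFin \o (fun x => - 1 * f x)) (cst 0%E).
  by apply=> x /[apply] /= -[] /eqP; rewrite mulN1r oppr_eq0 => /eqP ->.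
apply: Rintegral_ge0_ae0 => //.
  by apply: filterS fc => x fc /fc [->|->]; rewrite mulN1r ?oppr0// oppr_ge0 ltW.
by rewrite RintegralZl// Ef0 mulr0.
Qed.

End ae_rigidity.

Section rigidity.
Context (R : realType).
Notation T := (measurableTypeR R).
Variable gamma : {finite_measure set T -> \bar R}.
Variable I : set T.
Hypothesis mI : measurable I.
Hypothesis gamma_moment : gamma.-integrable I (EFin \o (fun y : T => y : R)).

Local Notation Int f := (gamma.-integrable I (EFin \o f)).
Local Notation E f := (Rintegral gamma I f).

Lemma integrable_affine (c e : R) : Int (fun y : T => c * y + e).
Proof.
apply: (integrable_addr mI (integrable_mulr mI c gamma_moment)).
exact: (finite_measure_integrable_cst gamma e).
Qed.

Lemma two_point_ae0 (D : T -> R) (p q : R) :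
  Int D -> Int (fun y => (y : R) * D y) ->
  \int[gamma]_(y in I) D y = 0 -> \int[gamma]_(y in I) ((y : R) * D y) = 0 ->
  {ae gamma, forall x, I x -> (x : R) != p -> (x : R) != q -> D x = 0} ->
  ae_eq gamma I (EFin \o D) (cst 0%E).
Proof.
move=> intD intyD ED0 EyD0 Dpq.
(* (y - p) D y vanishes off q, hence has constant sign and integral 0; so D
   vanishes off p and the same argument applies to D. *)
have intF : Int (fun y => (y : R) * D y - p * D y).
  exact: (integrable_subr mI intyD (integrable_mulr mI p intD)).
have F0 : ae_eq gamma I (EFin \o (fun y => (y : R) * D y - p * D y)) (cst 0%E).
  apply: (Rintegral_two_valued_ae0 mI (c := (q - p) * D q)) => //.
    apply: filterS Dpq => x + Ix => /(_ Ix) Dx.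
    have [->|xp] := eqVneq (x : R) p; first by left; rewrite subrr.
    have [->|xq] := eqVneq (x : R) q; first by right; rewrite mulrBl.
    by left; rewrite Dx// !mulr0 subrr.
  rewrite RintegralB// ?RintegralZl ?EyD0 ?ED0 ?mulr0 ?subrr//.
  exact: (integrable_mulr mI p intD).
apply: (Rintegral_two_valued_ae0 mI (c := D p)) => //.
apply: filterS F0 => x /[apply] /= -[] /eqP.
rewrite -mulrBl mulf_eq0 subr_eq0 => /orP[/eqP ->|/eqP ->]; [by right|by left].
Qed.

Variables k g : T -> R.
Hypothesis uk : unit_fun k.
Hypothesis ug : unit_fun g.
Hypothesis mass_eq : E k = E g.
Hypothesis moment_eq : E (fun y => (y : R) * k y) = E (fun y => (y : R) * g y).

(** Subtracting the affine function from [phi] does not change its integral against [k - g], and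
    what remains is nonnegative by the sign hypothesis. In the equality case it vanishes almost
    everywhere, which confines [k - g] to [p] and [q], where [two_point_ae0] takes over. *)
Lemma crossing_comparison (phi : T -> R) (c e : R) :
  Int phi ->
  (forall x, I x -> 0 <= (phi x - (c * (x : R) + e)) * (k x - g x)) ->
  E (fun y => phi y * g y) <= E (fun y => phi y * k y) /\
  forall p q : R,
  (forall x, I x -> (x : R) != p -> (x : R) != q -> phi x != c * (x : R) + e) ->
  E (fun y => phi y * g y) = E (fun y => phi y * k y) ->
  ae_eq gamma I (EFin \o g) (EFin \o k).
Proof.
move=> intphi sgn.
have intk := unit_fun_integrable gamma mI uk.
have intg := unit_fun_integrable gamma mI ug.
have intyk := integrableM_unit mI uk gamma_moment.
have intyg := integrableM_unit mI ug gamma_moment.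
have intpk := integrableM_unit mI uk intphi.
have intpg := integrableM_unit mI ug intphi.
pose D x := k x - g x.
have intD : Int D by exact: (integrable_subr mI) intk intg.
have intyD : Int (fun y => (y : R) * D y).
  apply: eq_integrable (integrable_subr mI intyk intyg) => //.
  by move=> x _ /=; rewrite mulrBr.
have ED : E D = 0 by rewrite RintegralB// mass_eq subrr.
have EyD : E (fun y => (y : R) * D y) = 0.
  under eq_Rintegral do rewrite mulrBr.
  by rewrite RintegralB// moment_eq subrr.
have eqF x : phi x * k x - phi x * g x + (- c * ((x : R) * D x) + - e * D x) =
    (phi x - (c * (x : R) + e)) * D x by rewrite /D; ring.
have int1 : Int (fun x => phi x * k x - phi x * g x).
  exact: (integrable_subr mI) intpk intpg.
have int2 : Int (fun x => - c * ((x : R) * D x) + - e * D x).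
  exact: (integrable_addr mI (integrable_mulr mI (- c) intyD)
    (integrable_mulr mI (- e) intD)).
have intF : Int (fun x => (phi x - (c * (x : R) + e)) * D x).
  by apply: eq_integrable (integrable_addr mI int1 int2) => // x _ /=; rewrite -eqF.
have EF : E (fun x => (phi x - (c * (x : R) + e)) * D x) =
    E (fun y => phi y * k y) - E (fun y => phi y * g y).
  under eq_Rintegral do rewrite -eqF.
  rewrite RintegralD// RintegralB// RintegralD//; last 2 first.
  - exact: (integrable_mulr mI (- c) intyD).
  - exact: (integrable_mulr mI (- e) intD).
  by rewrite !RintegralZl// ED EyD !mulr0 !addr0.
split; first by rewrite -subr_ge0 -EF; exact: Rintegral_ge0.
move=> p q nz Egk.
have F0 : ae_eq gamma I (EFin \o (fun x => (phi x - (c * (x : R) + e)) * D x))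
    (cst 0%E).
  apply: Rintegral_ge0_ae0 => //; first exact: aeW.
  by rewrite EF Egk subrr.
suff /filterS : ae_eq gamma I (EFin \o D) (cst 0%E).
  by apply=> x /[apply] /= -[] /eqP; rewrite subr_eq0 => /eqP ->.
apply: (two_point_ae0 _ _ ED EyD (p := p) (q := q)) => //.
apply: filterS F0 => x F0 Ix xp xq; have [/eqP] := F0 Ix.
by rewrite mulf_eq0 subr_eq0 (negbTE (nz _ Ix xp xq))/= => /eqP.
Qed.

(** An affine function has the same integral against [k] and [g]; taken as [phi], with the zero
    function as the line, it always falls in the equality case of [crossing_comparison]. This serves
    densities whose difference from any competitor changes sign at most once. *)
Lemma affine_rigidity (c e p : R) :
  (forall x, I x -> 0 <= (c * (x : R) + e) * (k x - g x)) ->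
  (forall x, I x -> (x : R) != p -> c * (x : R) + e != 0) ->
  ae_eq gamma I (EFin \o g) (EFin \o k).
Proof.
move=> sgn nz.
have inta := integrable_affine c e.
have [] := @crossing_comparison (fun x : T => c * (x : R) + e) 0 0 inta.
  by move=> x Ix; rewrite mul0r addr0 subr0; exact: sgn.
move=> _ /(_ p p); apply=> [x Ix xp _|]; first by rewrite mul0r addr0 nz.
have Eaff h : unit_fun h -> E (fun x : T => (c * (x : R) + e) * h x) =
    c * E (fun x => (x : R) * h x) + e * E h.
  move=> uh; have inth := unit_fun_integrable gamma mI uh.
  have intyh := integrableM_unit mI uh gamma_moment.
  have -> : E (fun x : T => (c * (x : R) + e) * h x) =
      E (fun x : T => c * ((x : R) * h x) + e * h x).
    by apply: eq_Rintegral => x _; rewrite mulrDl -mulrA.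
  rewrite RintegralD//; last 2 first.
  - exact: (integrable_mulr mI c intyh).
  - exact: (integrable_mulr mI e inth).
  by rewrite !RintegralZl.
by rewrite !Eaff// mass_eq moment_eq.
Qed.

End rigidity.

(** * Concave functions on an open interval *)

Section three_point_concavity.
Context (R : realType) (I : set R).
Implicit Types phi : R -> R.

(** The chord inequality at [y], with weights [(z - y) / (z - x)] and [(y - x) / (z - x)], cleared
    of denominators to suit linear arithmetic. *)
Definition concave3 phi := forall x y z, I x -> I z -> x < y -> y < z ->
  (z - y) * phi x + (y - x) * phi z <= (z - x) * phi y.

Definition strictly_concave3 phi := forall x y z, I x -> I z -> x < y -> y < z ->
  (z - y) * phi x + (y - x) * phi z < (z - x) * phi y.

Lemma concave_function3 phi : concave_function I phi -> concave3 phi.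
Proof.
move=> cphi x y z Ix Iz xy yz.
have xz : 0 < z - x by rewrite subr_gt0 (lt_trans xy).
set t := (z - y) / (z - x).
have t0 : 0 <= t by rewrite divr_ge0 ?subr_ge0 ?(ltW yz) ?(ltW (lt_trans xy yz)).
have t1 : t <= 1 by rewrite ler_pdivrMr// mul1r lerD2l lerN2 ltW.
have H : - phi (t * x + (1 - t) * z) <= t * (- phi x) + (1 - t) * (- phi z) :=
  cphi (Itv01 t0 t1) x z (mem_set Ix) (mem_set Iz).
have tz : t * (z - x) = z - y by rewrite /t divfK ?gt_eqF.
have yE : t * x + (1 - t) * z = y by lra.
rewrite -tz; have -> : y - x = (1 - t) * (z - x) by lra.
rewrite -subr_ge0.
rewrite (_ : _ - _ = (z - x) * (phi y - (t * phi x + (1 - t) * phi z))); last by ring.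
by rewrite mulr_ge0 ?(ltW xz)// subr_ge0; move: H; rewrite yE; lra.
Qed.

Lemma strictly_concave_function3 phi :
  strictly_concave_function I phi -> strictly_concave3 phi.
Proof.
move=> cphi x y z Ix Iz xy yz.
have xz : 0 < z - x by rewrite subr_gt0 (lt_trans xy).
set t := (z - y) / (z - x).
have tz : t * (z - x) = z - y by rewrite /t divfK ?gt_eqF.
have t0 : 0 < t by rewrite divr_gt0// subr_gt0.
have t1 : t < 1 by rewrite ltr_pdivrMr// mul1r ltrD2l ltrN2.
have := cphi x z t Ix Iz _ t0 t1; rewrite lt_eqF ?(lt_trans xy)// => /(_ isT).
have -> : t * x + (1 - t) * z = y by lra.
move=> H; rewrite -tz.
have -> : y - x = (1 - t) * (z - x) by lra.
rewrite -subr_gt0.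
rewrite (_ : _ - _ = (z - x) * (phi y - (t * phi x + (1 - t) * phi z))); last by ring.
by rewrite mulr_gt0// subr_gt0.
Qed.

Lemma strictly_concave3W phi : strictly_concave3 phi -> concave3 phi.
Proof. by move=> cphi x y z Ix Iz xy yz; exact/ltW/cphi. Qed.

Lemma concave3_measurable phi : is_interval I -> concave3 phi ->
  measurable_fun I phi.
Proof.
move=> itvI cphi.
(* The superlevel sets of a concave function are intervals. *)
apply: (measurability (@RGenOInfty.G R)) => [|/= _ [_] [c] -> <-].
  exact: RGenOInfty.measurableE.
apply: is_interval_measurable => x z [Ix /andP[cx _]] [Iz /andP[cz _]] y /andP[].
move: cx cz; rewrite !bnd_simp => cx cz.
rewrite le_eqVlt => /predU1P[<- _|xy]; first by split=> //; apply/andP.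
rewrite le_eqVlt => /predU1P[->|yz]; first by split=> //; apply/andP.
split; first by apply: (itvI x z) => //; rewrite !ltW.
apply/andP; split=> //; rewrite bnd_simp.
have := cphi x y z Ix Iz xy yz.
have : (z - y) * c < (z - y) * phi x by rewrite ltr_pM2l ?subr_gt0.
have : (y - x) * c < (y - x) * phi z by rewrite ltr_pM2l ?subr_gt0.
move=> h1 h2 h3.
rewrite -(@ltr_pM2l _ (z - x)) ?subr_gt0 ?(lt_trans xy)//; nra.
Qed.

(** The slope is the supremum of the slopes of the chords from [p] to the right. By concavity each
    chord arriving from the left is at least as steep, and openness of [I] supplies points on both
    sides, so the supremum exists. *)
Lemma supporting_line phi p : open I -> I p -> concave3 phi ->
  exists c, forall x, I x -> phi x <= c * x + (phi p - c * p).
Proof.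
move=> oI Ip cphi.
have /nbhs_ballP[r /= r0 prI] := open_nbhs_nbhs (conj oI Ip).
have r2 : `|r / 2| < r by rewrite ger0_norm ?divr_ge0 ?ltW//; lra.
have Iw : I (p - r / 2) by apply: prI; rewrite /ball/= opprB addrC subrK.
have Iz : I (p + r / 2) by apply: prI; rewrite /ball/= opprD addrA subrr add0r normrN.
pose S := [set (phi z - phi p) / (z - p) | z in [set z | I z /\ p < z]].
have ubS w : I w -> w < p -> ubound S ((phi p - phi w) / (p - w)).
  move=> {}Iw wp _ [z [{}Iz pz] <-].
  rewrite ler_pdivlMr ?subr_gt0// mulrAC ler_pdivrMr ?subr_gt0//.
  by have := cphi w p z Iw Iz wp pz; nra.
have S0 : S !=set0.
  exists ((phi (p + r / 2) - phi p) / (p + r / 2 - p)), (p + r / 2) => //.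
  by split=> //; lra.
have supS : has_sup S.
  split=> //; exists ((phi p - phi (p - r / 2)) / (p - (p - r / 2))).
  by apply: ubS => //; lra.
exists (sup S) => x Ix.
have [xp|px|->] := ltgtP x p; last by lra.
  have : sup S <= (phi p - phi x) / (p - x) by apply: ge_sup => //; exact: ubS.
  by rewrite ler_pdivlMr ?subr_gt0//; lra.
have : (phi x - phi p) / (x - p) <= sup S.
  by apply: sup_upper_bound => //; exists x.
by rewrite ler_pdivrMr ?subr_gt0//; lra.
Qed.

(** For [p = q] this is a supporting line; a second contact point would, by strict concavity, lift
    the midpoint above the line. For [p < q] it is the secant, and after multiplication by [q - p]
    each claim is one instance of concavity. *)
Lemma crossing_line phi p q : is_interval I -> open I -> I p -> I q -> p <= q ->
  concave3 phi ->
  exists c e, [/\ phi p = c * p + e, phi q = c * q + e,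
    forall x, p < x < q -> c * x + e <= phi x,
    forall x, I x -> (x < p) || (q < x) -> phi x <= c * x + e &
    strictly_concave3 phi -> forall x, I x -> x != p -> x != q ->
      phi x != c * x + e].
Proof.
move=> itvI oI Ip Iq; rewrite le_eqVlt => /predU1P[<- |pq] cphi.
  have [c cP] := supporting_line oI Ip cphi.
  exists c, (phi p - c * p); split; [lra|lra| | |].
  - by move=> x /andP[px xp]; have := lt_trans px xp; rewrite ltxx.
  - by move=> x Ix _; exact: cP.
  move=> sphi x Ix xp _; apply/eqP => phix.
  have /orP[{}xp|{}px] : (x < p) || (p < x) by rewrite -neq_lt.
  - have xm : x < (x + p) / 2 by lra.
    have mp : (x + p) / 2 < p by lra.
    have := sphi x _ p Ix Ip xm mp.
    have /cP : I ((x + p) / 2) by apply: (itvI x p) => //; rewrite !ltW.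
    by rewrite phix; nra.
  - have pm : p < (x + p) / 2 by lra.
    have mx : (x + p) / 2 < x by lra.
    have := sphi p _ x Ip Ix pm mx.
    have /cP : I ((x + p) / 2) by apply: (itvI p x) => //; rewrite !ltW.
    by rewrite phix; nra.
pose c := (phi q - phi p) / (q - p).
have qp0 : 0 < q - p by rewrite subr_gt0.
have cE : c * (q - p) = phi q - phi p by rewrite /c divfK ?gt_eqF.
exists c, (phi p - c * p).
have E x : (q - p) * (c * x + (phi p - c * p)) = (q - x) * phi p + (x - p) * phi q.
  transitivity ((c * (q - p)) * (x - p) + phi p * (q - p)); first ring.
  by rewrite cE; ring.
split; [lra|lra| | |].
- move=> x /andP[px xq]; rewrite -(ler_pM2l qp0) E.
  exact: cphi.
- move=> x Ix xpq; rewrite -(ler_pM2l qp0) E.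
  case/orP: xpq => [xp|qx].
    by have := cphi x p q Ix Iq xp pq; lra.
  by have := cphi p q x Ip Ix pq qx; lra.
move=> sphi x Ix xp xq; rewrite -(inj_eq (mulfI (lt0r_neq0 qp0))) E.
have /orP[{}xp|{}xp] : (x < p) || (p < x) by rewrite -neq_lt.
  by have := sphi x p q Ix Iq xp pq; lra.
have /orP[{}xq|{}xq] : (x < q) || (q < x) by rewrite -neq_lt.
  by have := sphi p x q Ip Iq xp xq; lra.
by have := sphi p q x Ip Ix pq xq; lra.
Qed.

End three_point_concavity.

(** The square root is the Euclidean norm of the vector [(1, y)], so this is a strict triangle
    inequality. Squaring reduces it to the strict Cauchy-Schwarz inequality [uv] for [(1, x)] and
    [(1, z)], whose defect is [(x - z) ^+ 2] by Lagrange's identity. *)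
Lemma sqrt_strictly_concave3 (R : realType) (I : set R) :
  strictly_concave3 I (fun y : R => - Num.sqrt (1 + y ^+ 2)).
Proof.
move=> x y z _ _ xy yz.
set u := Num.sqrt (1 + x ^+ 2); set v := Num.sqrt (1 + z ^+ 2).
set w := Num.sqrt (1 + y ^+ 2).
have u0 : 0 <= u by exact: sqrtr_ge0.
have v0 : 0 <= v by exact: sqrtr_ge0.
have w0 : 0 <= w by exact: sqrtr_ge0.
have S r : Num.sqrt (1 + r ^+ 2) ^+ 2 = 1 + r ^+ 2 :> R.
  by rewrite sqr_sqrtr// addr_ge0// sqr_ge0.
have uE : u ^+ 2 = 1 + x ^+ 2 := S x.
have vE : v ^+ 2 = 1 + z ^+ 2 := S z.
have wE : w ^+ 2 = 1 + y ^+ 2 := S y.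
have uv : 1 + x * z < u * v.
  apply: le_lt_trans (ler_norm _) _.
  rewrite -[ltRHS]ger0_norm ?mulr_ge0// -ltr_sqr ?nnegrE// !real_normK ?num_real//.
  rewrite exprMn uE vE -subr_gt0.
  rewrite (_ : _ - _ = (x - z) ^+ 2); last by ring.
  by rewrite exprn_even_gt0//= subr_eq0 lt_eqF// (lt_trans xy).
have zy0 : 0 < z - y by rewrite subr_gt0.
have yx0 : 0 < y - x by rewrite subr_gt0.
rewrite !mulrN -opprD ltrN2.
have zx0 : 0 < z - x by rewrite subr_gt0 (lt_trans xy).
rewrite -ltr_sqr ?nnegrE ?addr_ge0 ?mulr_ge0 ?(ltW zx0) ?(ltW zy0) ?(ltW yx0)//.
rewrite -subr_gt0.
have -> : ((z - y) * u + (y - x) * v) ^+ 2 - ((z - x) * w) ^+ 2 =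
   (z - y) ^+ 2 * (u ^+ 2) + (y - x) ^+ 2 * (v ^+ 2) - (z - x) ^+ 2 * (w ^+ 2)
    + (z - y) * (y - x) * (u * v) * 2 by ring.
rewrite uE vE wE.
have -> : (z - y) ^+ 2 * (1 + x ^+ 2) + (y - x) ^+ 2 * (1 + z ^+ 2) -
  (z - x) ^+ 2 * (1 + y ^+ 2) + (z - y) * (y - x) * (u * v) * 2 =
  2 * ((z - y) * (y - x)) * (u * v - (1 + x * z)) by ring.
by rewrite !mulr_gt0// subr_gt0.
Qed.

(** * Densities of quantile restrictions *)

Section quantile_density.
Context (R : realType).
Notation T := (measurableTypeR R).
Variable I : set T.
Hypothesis mI : measurable I.
Variable gamma : {finite_measure set T -> \bar R}.

Definition cdf_le (x : R) := fine (gamma ([set y : R | y <= x] `&` I)).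
Definition cdf_lt (x : R) := fine (gamma ([set y : R | y < x] `&` I)).

(* The density of gamma_0^t: at an atom, the fraction of its mass that lies below
   the level t; elsewhere the denominator is 0 and so is the quotient.  The test [t <= 0] makes the density of gamma_0^0 zero
   pointwise, and not merely almost everywhere. *)
Definition quantile_density (t x : R) : R :=
  if t <= 0 then 0 else if cdf_le x <= t then 1
  else Num.max 0 ((t - cdf_lt x) / (cdf_le x - cdf_lt x)).

Local Notation G := cdf_le.
Local Notation Gm := cdf_lt.
Local Notation k := quantile_density.

Lemma measurable_le_ray (x : R) : measurable ([set y : R | y <= x] : set T).
Proof.
rewrite (_ : [set y | y <= x] = [set` `]-oo, x]]) //.
Qed.

Lemma measurable_lt_ray (x : R) : measurable ([set y : R | y < x] : set T).
Proof.
rewrite (_ : [set y | y < x] = [set` `]-oo, x[]) //.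
Qed.
Local Hint Resolve measurable_le_ray measurable_lt_ray : core.

Lemma fine_measure_ge0 (A : set T) : 0 <= fine (gamma A).
Proof. exact: fine_ge0. Qed.

Lemma fine_measureK (A : set T) : measurable A -> (fine (gamma A))%:E = gamma A.
Proof. by move=> mA; rewrite fineK// fin_num_measure. Qed.

Lemma le_fine_measure (A B : set T) : measurable A -> measurable B ->
  A `<=` B -> fine (gamma A) <= fine (gamma B).
Proof.
by move=> mA mB AB; rewrite fine_le ?fin_num_measure// le_measure ?inE.
Qed.

Lemma cdf_lt_le x : Gm x <= G x.
Proof.
apply: le_fine_measure; [exact: measurableI|exact: measurableI|].
by apply: setSI => y /= /ltW.
Qed.

Lemma cdf_le_lt x y : x < y -> G x <= Gm y.
Proof.
move=> xy; apply: le_fine_measure; [exact: measurableI|exact: measurableI|].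
by apply: setSI => z /= /le_lt_trans; apply.
Qed.

Lemma cdf_le_nd x y : x <= y -> G x <= G y.
Proof.
rewrite le_eqVlt => /predU1P[->//|/cdf_le_lt /le_trans]; apply.
exact: cdf_lt_le.
Qed.

Lemma cdf_le_max x : G x <= fine (gamma I).
Proof. by apply: le_fine_measure => //; exact: measurableI. Qed.

Lemma quantile_density_npos t x : t <= 0 -> k t x = 0.
Proof. by rewrite /k => ->. Qed.

Lemma quantile_density1 t x : 0 < t -> G x <= t -> k t x = 1.
Proof. by rewrite /k ltNge => /negbTE -> ->. Qed.

Lemma quantile_density_full x : 0 < fine (gamma I) -> k (fine (gamma I)) x = 1.
Proof. by move=> m0; rewrite quantile_density1// cdf_le_max. Qed.

Lemma quantile_density0 t x : t < G x -> t <= Gm x -> k t x = 0.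
Proof.
move=> tG tGm; rewrite /k; case: ifP => // _; rewrite leNgt tG/=; apply/max_idPl.
by rewrite mulr_le0_ge0// ?invr_ge0 ?subr_ge0 ?cdf_lt_le// subr_le0.
Qed.

Lemma quantile_density_01 t x : 0 <= k t x <= 1.
Proof.
rewrite /k; case: ifP => _; first by rewrite lexx ler01.
case: ifPn => [_|]; first by rewrite ler01 lexx.
rewrite -ltNge => tG; rewrite le_max lexx/= ge_max ler01/=.
have := cdf_lt_le x; rewrite le_eqVlt => /predU1P[->|GmG].
  by rewrite subrr invr0 mulr0.
by rewrite ler_pdivrMr ?subr_gt0// mul1r lerD2r ltW.
Qed.

(** Measurability comes from monotonicity: once [cdf_le] exceeds [t > 0] at a point, the density is
    0 everywhere to its right. *)
Lemma quantile_density_unit t : unit_fun (k t : T -> R).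
Proof.
split; last exact: quantile_density_01.
have [t0|t0] := leP t 0.
  rewrite (_ : k t = cst 0); first exact: measurable_cst.
  by apply/funext => x; exact: quantile_density_npos.
apply: nonincreasing_measurable => // x y; rewrite le_eqVlt => /predU1P[->//|xy].
have [Gxt|tGx] := leP (G x) t.
  by rewrite (quantile_density1 t0 Gxt); have /andP[] := quantile_density_01 t y.
have tGm := lt_le_trans tGx (cdf_le_lt xy).
rewrite (@quantile_density0 t y) ?(ltW tGm)//; last exact: lt_le_trans (cdf_lt_le y).
by have /andP[] := quantile_density_01 t x.
Qed.

Lemma quantile_density_nd s t x : s <= t -> k s x <= k t x.
Proof.
move=> st; have [s0|s0] := leP s 0.
  by rewrite quantile_density_npos//; have /andP[] := quantile_density_01 t x.
have t0 := lt_le_trans s0 st.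
have [Gt|tG] := leP (G x) t.
  by rewrite (quantile_density1 t0 Gt); have /andP[] := quantile_density_01 s x.
have sG := le_lt_trans st tG.
rewrite /k [s <= 0]leNgt [t <= 0]leNgt s0 t0 [G x <= s]leNgt [G x <= t]leNgt.
rewrite sG tG/= le_max2// ler_wpM2r ?lerD2r//.
by rewrite invr_ge0 subr_ge0 cdf_lt_le.
Qed.

Lemma bigcup_measure_le (F : (set T)^nat) (c : \bar R) :
  (forall n, measurable (F n)) -> nondecreasing_seq F ->
  (forall n, (gamma (F n) <= c)%E) -> (gamma (\bigcup_n F n) <= c)%E.
Proof.
move=> mF ndF Fc.
have cF := nondecreasing_cvg_mu (mu := gamma) mF (bigcupT_measurable _ mF) ndF.
rewrite -(cvg_lim _ cF)//; apply: lime_le; first by apply/cvg_ex; eexists; exact: cF.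
exact: nearW.
Qed.

Lemma bigcap_measure_ge (F : (set T)^nat) (c : \bar R) :
  (forall n, measurable (F n)) -> nonincreasing_seq F ->
  (forall n, (c <= gamma (F n))%E) -> (c <= gamma (\bigcap_n F n))%E.
Proof.
move=> mF ndF Fc.
have F0 : (gamma (F 0%N) < +oo)%E by rewrite -ge0_fin_numE// fin_num_measure.
have mcap : measurable (\bigcap_n F n) by exact: bigcapT_measurable.
have cF := nonincreasing_cvg_mu (mu := gamma) F0 mF mcap ndF.
rewrite -(cvg_lim _ cF)//; apply: lime_ge; first by apply/cvg_ex; eexists; exact: cF.
exact: nearW.
Qed.

(** Continuity from below: the rays ending at the natural numbers exhaust [I]. *)
Lemma cdf_le_gt t : t < fine (gamma I) -> exists x, t < G x.
Proof.
move=> tm; apply/not_existsP => Gt; move: tm; apply/negP; rewrite -leNgt.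
rewrite -lee_fin fine_measureK//.
have -> : I = \bigcup_n ([set y : R | y <= n%:R] `&` I).
  rewrite -setI_bigcupl; apply/esym/setIidPr => x _.
  by exists (Num.bound x) => //=; exact/ltW/unstable.ltr_bound.
apply: bigcup_measure_le => [n|i j ij|n].
- exact: measurableI.
- by apply/subsetPset; apply: setSI => y /= /le_trans; apply; rewrite ler_nat.
- rewrite -fine_measureK; last exact: measurableI.
  by rewrite lee_fin leNgt; apply/negP/Gt.
Qed.

(** Continuity from above: the rays ending at the negative integers have empty intersection. *)
Lemma cdf_le_lt_pos t : 0 < t -> exists x, G x < t.
Proof.
move=> t0; apply/not_existsP => Gt; move: t0; apply/negP; rewrite -leNgt.
rewrite -lee_fin.
have E0 : gamma (\bigcap_n ([set y : R | y <= - n%:R] `&` I)) = 0%E.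
  rewrite -[RHS](measure0 gamma); congr (gamma _).
  apply/seteqP; split => // x /(_ (Num.bound (- x)) Logic.I)[/= + _].
  by rewrite lerNr leNgt unstable.ltr_bound.
apply: (@le_trans _ _ (gamma (\bigcap_n ([set y : R | y <= - n%:R] `&` I)))); last first.
  by rewrite E0.
apply: bigcap_measure_ge => [n|i j ij|n].
- exact: measurableI.
- apply/subsetPset; apply: setSI => y /= /le_trans; apply.
  by rewrite lerN2 ler_nat.
- rewrite -fine_measureK; last exact: measurableI.
  by rewrite lee_fin leNgt; apply/negP/Gt.
Qed.

Lemma cdf_lt_left q t : (forall x, x < q -> G x <= t) -> Gm q <= t.
Proof.
move=> Gt; rewrite -lee_fin fine_measureK; last exact: measurableI.
have -> : [set y : R | y < q] = \bigcup_n [set y : R | y <= q - n.+1%:R^-1].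
  apply/seteqP; split => [x /= xq|x [n _ /= /le_lt_trans]]; last first.
    by apply; rewrite ltrBlDr ltrDl invr_gt0.
  by have [n /ltW xn] := ltr_add_invr xq; exists n => //=; rewrite lerBrDr.
rewrite setI_bigcupl; apply: bigcup_measure_le => [n|i j ij|n].
- exact: measurableI.
- apply/subsetPset; apply: setSI => y /= /le_trans; apply.
  by rewrite lerD2l lerN2 lef_pV2 ?posrE// ler_nat.
- rewrite -fine_measureK; last exact: measurableI.
  by rewrite lee_fin; apply: Gt; rewrite ltrBlDr ltrDl invr_gt0.
Qed.

Lemma cdf_le_right q t : (forall x, q < x -> t <= G x) -> t <= G q.
Proof.
move=> Gt; rewrite -lee_fin fine_measureK; last exact: measurableI.
have -> : [set y : R | y <= q] = \bigcap_n [set y : R | y <= q + n.+1%:R^-1].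
  apply/seteqP; split => [x /= xq n _ /=|x xq /=].
    by rewrite (le_trans xq)// lerDl.
  rewrite leNgt; apply/negP => /ltr_add_invr[n]; rewrite ltNge.
  by move/negP; apply; exact: xq.
rewrite (_ : _ `&` I = \bigcap_n ([set y : R | y <= q + n.+1%:R^-1] `&` I)); last first.
  apply/seteqP; split => [x [Fx Ix] n _|x FIx]; first by split=> //; exact: Fx.
  by split=> [n _|]; [have [] := FIx n Logic.I|have [] := FIx 0%N Logic.I].
apply: bigcap_measure_ge => [n|i j ij|n].
- exact: measurableI.
- apply/subsetPset; apply: setSI => y /= /le_trans; apply.
  by rewrite lerD2l lef_pV2 ?posrE// ler_nat.
- rewrite -fine_measureK; last exact: measurableI.
  by rewrite lee_fin; apply: Gt; rewrite ltrDl invr_gt0.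
Qed.

(** The quantile is the supremum of the points where [cdf_le] is at most [t]; [0 < t] makes this set
    nonempty and [t < gamma I] makes it bounded. *)
Lemma quantile_exists t : is_interval (I : set R) -> 0 < t < fine (gamma I) ->
  exists q : R, [/\ I q, Gm q <= t <= G q, forall x, x < q -> G x <= t &
    forall x, q < x -> k t x = 0].
Proof.
move=> itvI /andP[t0 tm].
pose S := [set x : R | G x <= t].
have S0 : S !=set0 by have [x xt] := cdf_le_lt_pos t0; exists x; exact: ltW.
have [x1 x1t] := cdf_le_gt tm.
have ubS : ubound S x1.
  move=> x /= xt; rewrite leNgt; apply/negP => /ltW/cdf_le_nd.
  by rewrite leNgt (le_lt_trans xt).
have supS : has_sup S by split => //; exists x1.
have left x : x < sup S -> G x <= t.
  by move=> /(sup_gt S0)[y Sy /ltW/cdf_le_nd]; move/le_trans; apply.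
have right x : sup S < x -> t < G x.
  by move=> Sx; rewrite ltNge; apply/negP => /(sup_upper_bound supS); rewrite leNgt Sx.
have Gmt : Gm (sup S) <= t by exact: cdf_lt_left.
have tG : t <= G (sup S) by apply: cdf_le_right => x /right /ltW.
exists (sup S); split => //; last first.
- move=> x qx; apply: quantile_density0; first exact: right.
  (* The density vanishes at [x] once [t <= cdf_lt x]; the midpoint gives this, as its closed ray
     already has mass above [t]. *)
  pose y := (sup S + x) / 2; have qy : sup S < y by rewrite /y; lra.
  have yx : y < x by rewrite /y; lra.
  by apply: le_trans (cdf_le_lt yx); rewrite ltW// right.
- by rewrite Gmt.
(* The supremum lies in the interval [I] because [I] has points weakly on either side of it: without
   one on the left [cdf_le] would be 0 there, and without one on the right [cdf_lt] would be the
   total mass. *)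
have [y [/= yq Iy]] : ([set y : R | y <= sup S] `&` I) !=set0.
  apply/set0P/eqP => E; move: tG; rewrite /G E measure0/= leNgt t0.
  by [].
have [z [Iz zq]] : exists z, I z /\ sup S <= z.
  apply: contrapT => /forallNP E; move: Gmt; rewrite leNgt => /negP; apply.
  rewrite /Gm (_ : _ `&` I = I)//; apply/setIidPr => z Iz /=.
  by rewrite ltNge; apply/negP => zq; apply: (E z).
by apply: (itvI y z) => //; rewrite yq zq.
Qed.

Lemma Rintegral_two_valued (q c : R) (D : set T) : measurable D ->
  \int[gamma]_(x in D) (\1_[set y : R | y < q] x + c * \1_[set q] x) =
  fine (gamma ([set y : R | y < q] `&` D)) + c * fine (gamma ([set q] `&` D)).
Proof.
move=> mD.
have mq : measurable ([set q] : set T) by exact: measurable_set1.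
have intI (A : set T) : measurable A -> gamma.-integrable D (EFin \o \1_A).
  by move=> mA; apply: integrableS (integrable_indic _ mA) => //.
have EI (A : set T) : measurable A ->
    \int[gamma]_(x in D) \1_A x = fine (gamma (A `&` D)).
  by move=> mA; rewrite /Rintegral integral_indic.
rewrite RintegralD//; last 2 first.
- exact: intI.
- by apply: (integrable_mulr mD); exact: intI.
rewrite RintegralZl//; last exact: intI.
by rewrite !EI.
Qed.

(** Down-closed sets [C] cover both uses, rays and the whole line. If [0 < t] is below the mass of
    the part of [C] in [I], the quantile lies in [C]; the density then counts all the mass to the
    left of it and just enough of its atom to reach [t]. *)
Lemma Rintegral_quantile_density t (C : set T) : is_interval (I : set R) ->
  measurable C -> (forall x y : R, C y -> x <= y -> C x) ->
  \int[gamma]_(x in C `&` I) k t x = Num.max 0 (Num.min (fine (gamma (C `&` I))) t).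
Proof.
move=> itvI mC downC.
have mCI : measurable (C `&` I) by exact: measurableI.
set c := fine (gamma (C `&` I)).
have c0 : 0 <= c by exact: fine_measure_ge0.
have Gc y : C y -> G y <= c.
  move=> Cy; apply: le_fine_measure => //; first exact: measurableI.
  by apply: setSI => x /= xy; exact: (downC x y).
have cm : c <= fine (gamma I) by exact: le_fine_measure.
have [t0|t0] := leP t 0.
  rewrite (@eq_Rintegral _ _ _ _ _ (cst 0)) => [|x _]; last exact: quantile_density_npos.
  by rewrite Rintegral_cst// mul0r (max_idPl _)// ge_min t0 orbT.
have [ct|tc] := leP c t.
  rewrite (@eq_Rintegral _ _ _ _ _ (cst 1)).
    by rewrite Rintegral_cst// mul1r -/c; apply/esym/max_idPr.
  by move=> x /set_mem[Cx Ix]; rewrite quantile_density1// (le_trans (Gc _ Cx)).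
have [q [Iq /andP[Gmt tG] lq rq]] : exists q : R, [/\ I q, Gm q <= t <= G q,
    forall x, x < q -> G x <= t & forall x, q < x -> k t x = 0].
  by apply: quantile_exists => //; rewrite t0 (lt_le_trans tc).
(* Otherwise [C] lies strictly to the left of [q] and its part in [I] has mass at most
   [Gm q <= t]. *)
have Cq : C q.
  apply: contrapT => nCq; have : c <= t; last by rewrite leNgt tc.
  apply: le_trans Gmt; apply: le_fine_measure => //; first exact: measurableI.
  apply: setSI => y Cy /=; rewrite ltNge; apply/negP => qy.
  by apply: nCq; exact: downC qy.
have kE x : k t x = \1_[set y : R | y < q] x + k t q * \1_[set q] x.
  have -> : \1_[set y : R | y < q] x = ((x : R) < q)%R%:R :> R.
    by rewrite indicE; congr (nat_of_bool _)%:R; apply/idP/idP; rewrite inE.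
  have -> : \1_[set q] x = ((x : R) == q)%R%:R :> R.
    by rewrite indicE; congr (nat_of_bool _)%:R; apply/idP/idP; rewrite inE => /eqP.
  have [xq|qx|->] := ltgtP (x : R) q.
  - by rewrite quantile_density1 ?lq// mulr0 addr0.
  - by rewrite rq// mulr0 addr0.
  - by rewrite mulr1 add0r.
under eq_Rintegral do rewrite kE.
rewrite Rintegral_two_valued//.
have -> : [set y : R | y < q] `&` (C `&` I) = [set y : R | y < q] `&` I.
  rewrite setIA; congr (_ `&` _); apply/setIidPl => y /= yq.
  exact: downC (ltW yq).
have -> : [set q] `&` (C `&` I) = [set q] `&` I.
  by rewrite setIA; congr (_ `&` _); apply/setIidPl => y ->.
have GE : G q = Gm q + fine (gamma ([set q] `&` I)).
  rewrite /G (_ : _ `&` I = ([set y : R | y < q] `&` I) `|` ([set q] `&` I)); last first.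
    rewrite -setIUl; congr (_ `&` _); apply/seteqP; split => y /=.
      by rewrite le_eqVlt => /predU1P[->|]; [right|left].
    by case=> [/ltW//|->].
  rewrite measureU//; last 3 first.
  - exact: measurableI.
  - exact: measurableI.
  - apply/seteqP; split => // y [[/= yq _] [/= yq' _]].
    by rewrite yq' ltxx in yq.
  by rewrite fineD//; apply: fin_num_measure; exact: measurableI.
have -> : fine (gamma ([set q] `&` I)) = G q - Gm q by rewrite GE addrAC subrr add0r.
(* If [G q <= t], then [G q = t] and the atom counts in full; otherwise the fraction at [q]
   contributes exactly [t - Gm q]. *)
rewrite (max_idPr (ltW t0)) -/(Gm q) /k leNgt t0/=; case: ifPn => [Gt|].
  by rewrite mul1r addrC subrK; apply/eqP; rewrite eq_le Gt.
rewrite -ltNge => {}tG.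
rewrite (max_idPr _); last by rewrite divr_ge0// subr_ge0 ?cdf_lt_le.
rewrite divfK; first by rewrite addrC subrK.
by rewrite gt_eqF// subr_gt0 (le_lt_trans Gmt).
Qed.

End quantile_density.

(** * Uniqueness of a measure with given distribution function on an interval *)

Section cdf_uniqueness.
Context (R : realType).
Notation T := (measurableTypeR R).
Variable I : set T.
Hypothesis itvI : is_interval (I : set R).
Hypothesis openI : open (I : set R).

Let mI : measurable I. Proof. exact: is_interval_measurable. Qed.

Lemma cdf_unique (mu nu : borel_measure R) :
  concentrated I mu -> concentrated I nu ->
  (forall x : R, I x -> (mu ([set y : R | (y <= x)%R] `&` I) < +oo)%E) ->
  (forall x : R, I x ->
     mu ([set y : R | y <= x] `&` I) = nu ([set y : R | y <= x] `&` I)) ->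
  measure_eq mu nu.
Proof.
move=> muI nuI mufin mununu B mB.
(* The hypotheses only compare the rays that end inside I, so the sets outside I,
   which are null for both measures, are added to the generators. *)
pose ray x : set T := [set y : R | y <= x] `&` I.
pose G := [set A : set T | (exists2 x, I x & A = ray x) \/
                           (measurable A /\ A `<=` ~` I)].
have GI : G (~` I) by right; split => //; exact: measurableC.
have Gray x : I x -> G (ray x) by move=> Ix; left; exists x.
have mG : G `<=` measurable.
  by move=> A [[x Ix ->]|[]//]; apply: measurableI => //; exact: measurable_le_ray.
have [g Gg covg] : exists2 g : (set T)^nat, forall n, G (g n) & \bigcup_n g n = setT.
  (* A countable cover by generators of finite mass: the complement of [I] and the rays with
     rational endpoint in [I]. All other codes are sent to the complement. *)
  pose h (r : option rat) : set T :=
    if r is Some r then if `[< I (ratr r) >] then ray (ratr r) else ~` I else ~` I.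
  have Gh r : G (h r).
    by case: r => [r|//]; rewrite /h; case: asboolP => // Ir; exact: Gray.
  exists (fun n => if n is n'.+1 then h (unpickle n') else ~` I).
    by case=> [|n]; [exact: GI|exact: Gh].
  apply/seteqP; split => // y _; have [Iy|nIy] := pselect (I y); last by exists 0%N.
  have /nbhs_ballP[e /= e0 eI] := open_nbhs_nbhs (conj openI Iy).
  have /rat_in_itvoo[r] : (y : R) < y + e by rewrite ltrDl.
  rewrite in_itv/= => /andP[yr re].
  exists (pickle r).+1; first exact: Logic.I.
  rewrite pickleK /h.
  have Ir : I (ratr r).
    apply: eI; rewrite /ball/= distrC ger0_norm ?subr_ge0 ?ltW//.
    by rewrite ltrBlDl.
  by case: asboolP => // _; split => //; exact: ltW.
have setIG : setI_closed G.
  move=> A A' [[x Ix ->]|[mA AI]] [[x' Ix' ->]|[mA' AI']].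
  - left; exists (Num.min x x'); first by case: leP.
    rewrite /ray setIACA setIid; congr (_ `&` _).
    by apply/seteqP; split => y /=; rewrite le_min => /andP.
  - right; split; last by move=> y [_ /AI'].
    by apply: measurableI => //; apply: mG; exact: Gray.
  - right; split; last by move=> y [/AI].
    by apply: measurableI => //; apply: mG; exact: Gray.
  - by right; split; [exact: measurableI|move=> y [/AI]].
have mu0 A : measurable A -> A `<=` ~` I -> mu A = 0%E.
  by move=> mA AI; apply: subset_measure0 AI muI => //; exact: measurableC.
have nu0 A : measurable A -> A `<=` ~` I -> nu A = 0%E.
  by move=> mA AI; apply: subset_measure0 AI nuI => //; exact: measurableC.
have munuG A : G A -> mu A = nu A.
  by move=> [[x Ix ->]|[mA AI]]; [exact: mununu|rewrite mu0// nu0].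
have mug n : (mu (g n) < +oo)%E.
  by case: (Gg n) => [[x Ix ->]|[mA AI]]; [exact: mufin|rewrite mu0].
apply: (@g_sigma_algebra_measure_unique _ R T G mG g Gg covg mu nu setIG munuG mug).
(* It suffices that the sigma-algebra generated by [G] contains the open right rays. Their
   complements are closed left rays, which are split along [I]. *)
have : (@RGenOInfty.G R).-sigma.-measurable B by rewrite -RGenOInfty.measurableE.
apply: smallest_sub; first exact: smallest_sigma_algebra.
pose T' := g_sigma_algebraType G.
have sI : @measurable _ T' I.
  by rewrite -[I]setCK; apply: measurableC; exact: sub_sigma_algebra.
move=> _ [x ->]; rewrite -setCitvl.
apply: (@measurableC _ T').
rewrite (_ : [set` _] = ([set` `]-oo, x]] `&` I) `|` ([set` `]-oo, x]] `&` ~` I)); last first.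
  by rewrite -setIUr setUv setIT.
apply: (@measurableU _ T'); last first.
  apply: sub_sigma_algebra; right; split; last by move=> y [].
  by apply: measurableI => //; exact: measurableC.
have [Ix|nIx] := pselect (I x).
  by apply: sub_sigma_algebra; left; exists x => //; rewrite /ray; congr (_ `&` _);
    apply/seteqP; split => y; rewrite /= in_itv.
(* A point [x] outside the interval [I] lies on one side of it, so the ray meets [I] in the empty
   set or in all of [I]. *)
have [[y [Iy xy]]|ny] := pselect (exists y, I y /\ x < y).
  rewrite (_ : _ `&` I = set0); first exact: (@measurable0 _ T').
  apply/seteqP; split => // z [/= + Iz]; rewrite in_itv/= => zx.
  by apply: nIx; apply: (itvI Iz Iy); rewrite zx ltW.
rewrite (_ : _ `&` I = I)//; apply/setIidPr => z Iz; rewrite /= in_itv/= leNgt.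
by apply/negP => xz; apply: ny; exists z.
Qed.

End cdf_uniqueness.

(** Turns the difference of the integrals of [k t] and [k s] over a ray of mass [c] into the formula
    that defines a quantile restriction. *)
Lemma clip_sub (R : realDomainType) (c s t : R) : 0 <= c -> 0 <= s -> s <= t ->
  Num.max 0 (Num.min c t) - Num.max 0 (Num.min c s) =
  Num.min (Num.max (c - s) 0) (t - s).
Proof.
move=> c0 s0 st.
have pos r : 0 <= r -> Num.max 0 (Num.min c r) = Num.min c r.
  by move=> r0; apply/max_idPr; rewrite le_min c0.
rewrite !pos ?(le_trans s0)//; have [cs|sc] := leP c s.
  rewrite (min_idPl (le_trans cs st)) subrr (max_idPr _) ?subr_le0//.
  by apply/esym/min_idPl; rewrite subr_ge0.
rewrite (max_idPl _) ?subr_ge0 ?(ltW sc)//.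
by have [ct|tc] := leP c t; apply/esym; [apply/min_idPl|apply/min_idPr];
  rewrite lerD2r// ltW.
Qed.

(** * Quantile restrictions as measures with a density *)

Section quantile_restriction_density.
Context (R : realType).
Notation T := (measurableTypeR R).
Variable I : set T.
Hypothesis itvI : is_interval (I : set R).
Hypothesis openI : open (I : set R).
Variable gamma : {finite_measure set T -> \bar R}.

Let mI : measurable I. Proof. exact: is_interval_measurable. Qed.

Local Notation k := (quantile_density I gamma).

Definition connected_density (s t : R) : T -> R := fun x => k t x - k s x.

Lemma connected_density_unit s t : s <= t -> unit_fun (connected_density s t).
Proof.
move=> st; have uk := quantile_density_unit mI gamma; split.
  by apply: measurable_funB; [exact: (uk t).1|exact: (uk s).1].
move=> x; rewrite subr_ge0 quantile_density_nd//=.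
have /andP[_ kt1] := (uk t).2 x; have /andP[ks0 _] := (uk s).2 x.
by rewrite (le_trans _ kt1)// gerBl.
Qed.

Lemma Rintegral_connected_density s t (C : set T) : measurable C ->
  (forall x y : R, C y -> x <= y -> C x) ->
  \int[gamma]_(x in C `&` I) connected_density s t x =
  Num.max 0 (Num.min (fine (gamma (C `&` I))) t) -
  Num.max 0 (Num.min (fine (gamma (C `&` I))) s).
Proof.
move=> mC downC; have mCI : measurable (C `&` I) by exact: measurableI.
have intk r := unit_fun_integrable gamma mCI (quantile_density_unit mI gamma r).
by rewrite RintegralB// !Rintegral_quantile_density.
Qed.

(** The measure with this density meets the specification, so the definite description does not fall
    back on its default value; [cdf_unique] then identifies the two. *)
Lemma quantile_restriction_density s t : 0 <= s -> s <= t ->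
  has_density gamma I (quantile_restriction I gamma s t) (connected_density s t).
Proof.
move=> s0 st; have u := connected_density_unit st.
have [nu nud] := exists_density_measure gamma mI u.
have nuE (C : set T) : measurable C ->
    nu C = (\int[gamma]_(x in C `&` I) connected_density s t x)%:E.
  move=> mC; rewrite nud//; have mCI : measurable (C `&` I) by exact: measurableI.
  by have /fineK <- := integrable_fin_num mCI (unit_fun_integrable gamma mCI u).
have qnu : is_quantile_restriction I gamma s t nu.
  split; first by rewrite /concentrated nud ?setICl ?integral_set0//; exact: measurableC.
  move=> x Ix; have mx := measurable_le_ray x.
  have mxI : measurable ([set y : R | y <= x] `&` I : set T) by exact: measurableI.
  rewrite nuE// -setIA setIid Rintegral_connected_density//; last first.
    by move=> y z /= zx yz; exact: le_trans zx.
  rewrite -(fine_measureK gamma mxI) -EFinB -EFin_max -EFin_min; congr EFin.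
  set c := fine _; have c0 : 0 <= c by exact: fine_measure_ge0.
  by rewrite clip_sub.
have [qI qE] : is_quantile_restriction I gamma s t (quantile_restriction I gamma s t).
  exact: (@xgetI {classic borel_measure R} (mzero : borel_measure R)
    [set rho : borel_measure R | is_quantile_restriction I gamma s t rho] nu qnu).
move=> B mB; rewrite -nud//; apply: (cdf_unique itvI openI qI qnu.1) => // x Ix.
- rewrite qE// -(qnu.2 x Ix); have mx := measurable_le_ray x.
  by rewrite (nuE _ (measurableI _ _ mx mI)) ltry.
- by rewrite qE// qnu.2.
Qed.

End quantile_restriction_density.

Lemma clip_lipschitz (R : realFieldType) (c s t : R) : s <= t ->
  Num.max 0 (Num.min c t) - Num.max 0 (Num.min c s) <= t - s.
Proof.
move=> st; have [ct|tc] := leP c t; have [cs|sc] := leP c s;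
  have [c0|c0] := leP 0 c; have [t0|t0] := leP 0 t; have [s0|s0] := leP 0 s;
  lra.
Qed.

(** * Existence of the connected part *)

Section partial_moment.
Context (R : realType).
Notation T := (measurableTypeR R).
Variable I : set T.
Hypothesis itvI : is_interval (I : set R).
Variable gamma : {finite_measure set T -> \bar R}.
Hypothesis gamma_moment : gamma.-integrable I (EFin \o (fun y : T => y : R)).

Let mI : measurable I. Proof. exact: is_interval_measurable. Qed.

Local Notation Int f := (gamma.-integrable I (EFin \o f)).
Local Notation k := (quantile_density I gamma).
Local Notation m := (fine (gamma I)).

Lemma Rintegral_quantile_densityT t :
  \int[gamma]_(x in I) k t x = Num.max 0 (Num.min m t).
Proof.
by have := Rintegral_quantile_density mI gamma t itvI measurableT
  (fun _ _ _ _ => Logic.I); rewrite setTI.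
Qed.

Lemma Rintegral_quantile_density_itv t : 0 <= t <= m ->
  \int[gamma]_(x in I) k t x = t.
Proof.
move=> /andP[t0 tm]; rewrite Rintegral_quantile_densityT.
by rewrite (min_idPr tm); exact/max_idPr.
Qed.

(** For levels between 0 and the total mass this is the first moment of $\gamma_0^t$, an
    unnormalized Lorenz curve. It makes sense for every real [t], so continuity can be stated on the
    whole line. *)
Definition partial_moment t := \int[gamma]_(y in I) ((y : R) * k t y).
Local Notation M := partial_moment.

Lemma moment_connected_density s t :
  \int[gamma]_(y in I) ((y : R) * connected_density I gamma s t y) = M t - M s.
Proof.
have intk r := integrableM_unit mI (quantile_density_unit mI gamma r) gamma_moment.
under eq_Rintegral do rewrite mulrBr.
by rewrite RintegralB.
Qed.

(* Splitting |y| = min(|y|, n) + tail n y bounds the increments of the partial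
   moment even when y is unbounded. *)
Let tail n (y : T) : R := `|y : R| - Num.min `|y : R| n%:R.

Let tail_ge0 n y : 0 <= tail n y.
Proof. by rewrite subr_ge0 ge_min lexx. Qed.

Local Hint Resolve tail_ge0 : core.

Let tail_le n y : tail n y <= `|y : R|.
Proof. by rewrite gerBl le_min normr_ge0 ler0n. Qed.

Local Hint Resolve tail_le : core.

Let measurable_tail n : measurable_fun setT (tail n).
Proof.
have mn : measurable_fun setT (fun y : T => `|y : R|) by exact: measurableT_comp.
by apply: measurable_funB => //; exact: (measurable_minr mn (measurable_cst _)).
Qed.

Let integrable_norm_id : Int (fun y : T => `|y : R|).
Proof. exact: integrable_norm gamma_moment. Qed.

Let integrable_tail n : Int (tail n).
Proof.
apply: (le_integrable mI _ _ integrable_norm_id).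
  apply/measurable_EFinP/measurable_funTS; exact: measurable_tail.
by move=> y _; rewrite /= lee_fin normr_id (ger0_norm (tail_ge0 n y)) tail_le.
Qed.

(** Dominated convergence with bound [|y|]: at each [y] the tail is 0 from some [n] on. *)
Lemma tail_moment_small (e : R) : 0 < e ->
  exists n, \int[gamma]_(y in I) tail n y < e.
Proof.
move=> e0.
have cv : (\int[gamma]_(y in I) (tail n y)%:E @[n --> \oo] -->
    0)%E.
  rewrite -(integral0 gamma I).
  apply: (@dominated_cvg _ T R gamma I mI (fun n y => (tail n y)%:E) (cst 0%E)
    (fun y : T => `|y : R|%:E)) => //.
  - by move=> n; apply/measurable_EFinP/measurable_funTS; exact: measurable_tail.
  - move=> y _; apply: cvg_near_cst.
    exists (Num.bound `|y : R|) => // n /= yn.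
    rewrite /tail (min_idPl _) ?subrr//.
    by rewrite (le_trans (ltW (unstable.ltr_bound _)))// ler_nat.
  - by move=> n y _; rewrite gee0_abs ?lee_fin.
move/fine_cvgP: cv => [_ /cvgrPdist_lt /(_ e e0)[n _ /(_ n (leqnn n))]] /=.
rewrite sub0r normrN => nP; exists n; apply: le_lt_trans nP; exact: ler_norm.
Qed.

(** The increment is the moment of a density with values in [[0, 1]] and mass at most [t - s]. The
    truncated part of [|y|] is at most [n], and on the tail the density is bounded by 1. *)
Lemma partial_moment_diff s t n : s <= t ->
  `|M t - M s| <= n%:R * (t - s) + \int[gamma]_(y in I) tail n y.
Proof.
move=> st.
have uc := connected_density_unit itvI gamma st.
have intc := unit_fun_integrable gamma mI uc.
have intyc := integrableM_unit mI uc gamma_moment.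
rewrite -moment_connected_density.
apply: (le_trans (le_normr_Rintegral mI intyc)).
apply: (@le_trans _ _ (\int[gamma]_(y in I)
    (n%:R * connected_density I gamma s t y + tail n y))).
  apply: le_Rintegral => //; first exact: integrable_norm intyc.
    apply: (integrable_addr mI _ (integrable_tail n)).
    exact: (integrable_mulr mI n%:R intc).
  move=> y Iy; have /andP[c0 c1] := uc.2 y.
  rewrite normrM (ger0_norm c0).
  have -> : `|y : R| = Num.min `|y : R| n%:R + tail n y by rewrite addrC subrK.
  rewrite mulrDl lerD//.
    by rewrite ler_wpM2r// ge_min lexx orbT.
  by rewrite ler_piMr.
rewrite RintegralD//; last exact: (integrable_mulr mI n%:R intc).
rewrite lerD2r RintegralZl// ler_wpM2l//.
have intk r := unit_fun_integrable gamma mI (quantile_density_unit mI gamma r).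
rewrite RintegralB//.
rewrite !Rintegral_quantile_densityT.
exact: clip_lipschitz.
Qed.

Lemma partial_moment_continuous : continuous M.
Proof.
move=> t; apply/cvgrPdist_lt => e e0.
have e2 : 0 < e / 2 by lra.
have [n ne] := tail_moment_small e2.
(* The successor keeps the denominator positive when [n = 0]. *)
have d0 : 0 < e / 2 / n.+1%:R by rewrite divr_gt0.
have close a b : a <= b -> b - a < e / 2 / n.+1%:R -> `|M b - M a| < e.
  move=> ab; rewrite ltr_pdivlMr// => bae.
  have nba : n%:R * (b - a) <= (b - a) * n.+1%:R.
    by rewrite mulrC ler_wpM2l ?subr_ge0// ler_nat.
  by have := partial_moment_diff n ab; lra.
near=> s.
have st : `|t - s| < e / 2 / n.+1%:R by near: s; exact: cvgr_dist_lt.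
have [ts|/ltW ts] := leP s t.
  by apply: close => //; rewrite -(ger0_norm (_ : 0 <= t - s)) ?subr_ge0.
rewrite distrC; apply: close => //.
by rewrite -(ger0_norm (_ : 0 <= s - t)) ?subr_ge0// distrC.
Unshelve. all: by end_near. Qed.

Lemma partial_moment0 : M 0 = 0.
Proof.
rewrite /M (@eq_Rintegral _ _ _ _ _ (cst 0)) ?Rintegral_cst ?mul0r// => x _.
by rewrite quantile_density_npos// mulr0.
Qed.

Lemma partial_moment_full : M m = \int[gamma]_(y in I) (y : R).
Proof.
(* When [gamma I = 0] the density at level [m] is 0 rather than 1, but then every integral over [I]
   vanishes. *)
have := fine_measure_ge0 gamma I; rewrite le_eqVlt => /predU1P[m0|m0].
  have gI0 : gamma I = 0%E by rewrite -(fine_measureK gamma mI) -m0.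
  have E0 f : measurable_fun I (EFin \o f) -> \int[gamma]_(y in I) f y = 0.
    by move=> mf; rewrite /Rintegral null_set_integral.
  rewrite /M !E0//; first exact: (measurable_int gamma gamma_moment).
  apply: (measurable_int gamma).
  exact: (integrableM_unit mI (quantile_density_unit mI gamma _) gamma_moment).
by apply: eq_Rintegral => x _; rewrite quantile_density_full// mulr1.
Qed.

(** The bounds on [b] are the values at [s = 0] and [s = m - a] of the continuous function
    [M (s + a) - M s], the moment of the connected density of mass [a] that starts at level [s]. *)
Lemma connected_density_exists a b : 0 <= a <= m ->
  M a - M 0 <= b -> b <= M m - M (m - a) ->
  exists s, [/\ 0 <= s, s + a <= m & M (s + a) - M s = b].
Proof.
move=> /andP[a0 am] b1 b2.
have ma : 0 <= m - a by rewrite subr_ge0.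
have cH : continuous (fun s => M (s + a) - M s).
  move=> s; apply: cvgB; last exact: partial_moment_continuous.
  apply: (@cvg_comp _ _ _ (fun s => s + a) M).
    by apply: cvgD; [exact: cvg_id|exact: cvg_cst].
  exact: partial_moment_continuous.
have [||s] := @IVT _ (fun s => M (s + a) - M s) 0 (m - a) b ma.
- exact: continuous_subspaceT.
- by rewrite add0r subrK ge_min b1/= le_max b2 orbT.
rewrite in_itv/= => /andP[s0 sma] sb.
by exists s; split => //; rewrite -lerBrDr.
Qed.

End partial_moment.

(** * Optimality *)

Section optimality.
Context (R : realType).
Notation T := (measurableTypeR R).
Variable I : set T.
Hypothesis itvI : is_interval (I : set R).
Hypothesis openI : open (I : set R).
Variable gamma : {finite_measure set T -> \bar R}.
Hypothesis gamma_moment : gamma.-integrable I (EFin \o (fun y : T => y : R)).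

Let mI : measurable I. Proof. exact: is_interval_measurable. Qed.

Local Notation Int f := (gamma.-integrable I (EFin \o f)).
Local Notation E f := (Rintegral gamma I f).
Local Notation k := (quantile_density I gamma).
Local Notation c := (connected_density I gamma).
Local Notation m := (fine (gamma I)).

(** With a supporting line [l] above [phi], the sum of [|l|] and the negative part of [phi]
    dominates [|phi|]. *)
Lemma concave_integrable (phi : T -> R) : I !=set0 -> concave3 I phi ->
  (\int[gamma]_(y in I) (phi^\- y)%:E < +oo)%E -> Int phi.
Proof.
move=> [p Ip] cphi phi_neg.
have mphi : measurable_fun I phi := concave3_measurable itvI cphi.
have [s sP] := supporting_line openI Ip cphi.
have inta := integrable_affine mI gamma_moment s (phi p - s * (p : R)).
have intn : Int phi^\-.
  apply/integrableP; split; first exact/measurable_EFinP/measurable_funrneg.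
  by under eq_integral do rewrite gee0_abs ?lee_fin//.
apply: (le_integrable mI _ _ (integrable_addr mI (integrable_norm inta) intn)).
  exact/measurable_EFinP.
move=> x Ix; rewrite /= lee_fin [leRHS]ger0_norm ?addr_ge0//.
have := sP x Ix; set l := _ + _ => phil.
have ll := ler_norm l; have l0 := normr_ge0 l.
have n0 : 0 <= phi^\- x by exact: funrneg_ge0.
have phin : - phi x <= phi^\- x by rewrite /funrneg le_max lexx.
by rewrite ler_norml; apply/andP; split; lra.
Qed.

Lemma ae_eq_Rintegral (f g h : T -> R) : Int f -> unit_fun g -> unit_fun h ->
  ae_eq gamma I (EFin \o g) (EFin \o h) ->
  E (fun y => f y * g y) = E (fun y => f y * h y).
Proof.
move=> intf ug uh gh; congr fine; apply: ae_eq_integral => //.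
- exact: (measurable_int gamma (integrableM_unit mI ug intf)).
- exact: (measurable_int gamma (integrableM_unit mI uh intf)).
- by apply: filterS gh => x /[apply] -[->].
Qed.

Lemma connected_density_optimal s t (g phi : T -> R) :
  0 <= s -> s <= t -> t <= m -> unit_fun g ->
  E (c s t) = E g -> E (fun y => (y : R) * c s t y) = E (fun y => (y : R) * g y) ->
  Int phi -> concave3 I phi ->
  E (fun y => phi y * g y) <= E (fun y => phi y * c s t y) /\
  (strictly_concave3 I phi ->
   E (fun y => phi y * g y) = E (fun y => phi y * c s t y) ->
   ae_eq gamma I (EFin \o g) (EFin \o c s t)).
Proof.
move=> s0 st tm ug mass moment intphi cphi.
have uc := connected_density_unit itvI gamma st.
(* Almost everywhere equality gives both claims at once, which disposes of every degenerate case
   where [c s t] has no competitor. *)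
have ae_suff : ae_eq gamma I (EFin \o g) (EFin \o c s t) ->
  E (fun y => phi y * g y) <= E (fun y => phi y * c s t y) /\
  (strictly_concave3 I phi ->
   E (fun y => phi y * g y) = E (fun y => phi y * c s t y) ->
   ae_eq gamma I (EFin \o g) (EFin \o c s t)).
  by move=> gc; split => //; rewrite (ae_eq_Rintegral intphi ug uc gc).
have g01 x := (andP (ug.2 x)).
move: st uc mass moment ae_suff.
rewrite le_eqVlt => /predU1P[<-|st] uc mass moment ae_suff.
  (* For [s = t] the density is 0 and its difference from [g] is nonpositive, so the constant [-1]
     serves as the affine function; it has no zero, and [p] is arbitrary. *)
  apply/ae_suff/(affine_rigidity mI gamma_moment uc ug mass moment
    (c := 0) (e := -1) (p := 0)).
    by move=> x _; have [? ?] := g01 x; rewrite /connected_density; nra.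
  by move=> x _ _; rewrite mul0r add0r oppr_eq0 oner_eq0.
have m0 : 0 < m by lra.
have threshold r : 0 < r < m -> exists q : R, [/\ I q,
    forall x : T, (x : R) < q -> k r x = 1 & forall x : T, q < (x : R) -> k r x = 0].
  move=> rm; have [q [Iq _ lq rq]] := quantile_exists mI itvI rm.
  exists q; split => // y yq; case/andP: rm => r0 _.
  by rewrite quantile_density1// lq.
have k0 x : k 0 x = 0 by exact: quantile_density_npos.
have km x : k m x = 1 by exact: quantile_density_full.
(* If s = 0 or t = gamma(I), one of the two quantiles is missing; then c s t is
   the only density with its mass and moment. *)
have rigid := affine_rigidity mI gamma_moment uc ug mass moment.
have [s0'|s0'] := eqVneq s 0; have [tm'|tm'] := eqVneq t m.
- apply/ae_suff/(rigid 0 1 0) => [x _|x _ _].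
    by have [? ?] := g01 x; rewrite /connected_density s0' tm' km k0; nra.
  by rewrite mul0r add0r oner_eq0.
- have [|q [Iq lq rq]] := threshold t.
    by rewrite (le_lt_trans s0 st) lt_neqAle tm'.
  (* The density is [k t], equal to 1 left of [q] and 0 right of it, so its difference from [g] has
     the sign of [q - x]. *)
  apply/ae_suff/(rigid (-1) q q) => [x _|x _ xq]; last first.
    by rewrite mulN1r addrC subr_eq0 eq_sym.
  rewrite /connected_density s0' k0 subr0; have [? ?] := g01 x.
  by have [xq|qx|->] := ltgtP (x : R) q; [rewrite lq//|rewrite rq//|]; nra.
- have [|p [Ip lp rp]] := threshold s.
    by rewrite lt_neqAle eq_sym s0' s0 (lt_le_trans st).
  (* The density is [1 - k s], and its difference from [g] has the sign of [x - p]. *)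
  apply/ae_suff/(rigid 1 (- p) p) => [x _|x _ xp]; last first.
    by rewrite mul1r subr_eq0.
  rewrite /connected_density tm' km; have [? ?] := g01 x.
  by have [xp|px|->] := ltgtP (x : R) p; [rewrite lp//|rewrite rp//|]; nra.
have [|p [Ip lp rp]] := threshold s.
  by rewrite lt_neqAle eq_sym s0' s0 (lt_le_trans st).
have [|q [Iq lq rq]] := threshold t.
  by rewrite (le_lt_trans s0 st) lt_neqAle tm'.
(* Between [q] and [p] one would have [k s = 1] and [k t = 0], against monotonicity in the level. *)
have pq : p <= q.
  rewrite leNgt; apply/negP => qp.
  have h1 : q < (p + q) / 2 by lra.
  have h2 : (p + q) / 2 < p by lra.
  have := quantile_density_nd mI gamma ((p + q) / 2) (ltW st).
  by rewrite lp// rq// ler10.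
have [a [e [phip phiq inside outside strict]]] :=
  crossing_line itvI openI Ip Iq pq cphi.
have [x Ix|le_phi eq_phi] := crossing_comparison mI gamma_moment uc ug mass moment
  (c := a) (e := e) intphi.
  have [g0 g1] := g01 x; rewrite /connected_density.
  (* At [p] and [q] the density may be any fraction, but there the line meets [phi] and the product
     is 0. *)
  have [->|xp] := eqVneq (x : R) p; first by rewrite phip subrr mul0r.
  have [->|xq] := eqVneq (x : R) q; first by rewrite phiq subrr mul0r.
  have /orP[{}xp|{}xp] : (x < p) || (p < x) by rewrite -neq_lt.
    rewrite lp// lq ?(lt_le_trans xp)//.
    by have := outside x Ix; rewrite xp => /(_ isT); nra.
  rewrite rp//; have /orP[{}xq|{}xq] : (x < q) || (q < x) by rewrite -neq_lt.
    by rewrite lq//; have := inside x; rewrite xp xq => /(_ isT); nra.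
  by rewrite rq//; have := outside x Ix; rewrite xq orbT => /(_ isT); nra.
split => // sphi; apply: (eq_phi p q) => x Ix; exact: strict.
Qed.

End optimality.

(** * Membership, integrals and complements in terms of densities *)

Section submeasure_densities.
Context (R : realType).
Notation T := (measurableTypeR R).
Variable I : set T.
Hypothesis mI : measurable I.
Variable gamma : {finite_measure set T -> \bar R}.
Hypothesis gamma_I : concentrated I gamma.
Hypothesis gamma_moment : gamma.-integrable I (EFin \o (fun y : T => y : R)).

Local Notation Int f := (gamma.-integrable I (EFin \o f)).
Local Notation E f := (Rintegral gamma I f).
Local Notation compl g := (fun x : T => 1 - g x).
Implicit Types f g h : T -> R.

Lemma integral_density_fin (mu : borel_measure R) (g f : T -> R) :
  unit_fun g -> has_density gamma I mu g -> Int f ->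
  (\int[mu]_(x in I) (f x)%:E)%E = (E (fun x => f x * g x))%:E.
Proof.
move=> ug mug intf; rewrite (integral_density mI ug mug); last first.
  by apply/measurable_EFinP; exact: measurable_int intf.
by have /fineK <- := integrable_fin_num mI (integrableM_unit mI ug intf).
Qed.

Lemma density_mass (mu : borel_measure R) (g : T -> R) :
  unit_fun g -> has_density gamma I mu g -> mu I = (E g)%:E.
Proof.
move=> ug mug; rewrite mug// setIid.
by have /fineK <- := integrable_fin_num mI (unit_fun_integrable gamma mI ug).
Qed.

(** Concentration on [I] and domination by [gamma] come with the density, so only mass and moment
    are left to check. *)
Lemma submeasuresP (a b : R) (mu : borel_measure R) (g : T -> R) :
  unit_fun g -> has_density gamma I mu g ->
  submeasures I gamma a b mu <->
  E g = a /\ E (fun y => (y : R) * g y) = b.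
Proof.
move=> ug mug; rewrite /submeasures /= /first_moment.
rewrite (density_mass ug mug) (integral_density_fin ug mug gamma_moment).
split=> [[_ [->] [->] _]//|[-> ->]]; split => //; last exact: density_le mug.
by rewrite /concentrated mug ?setICl ?integral_set0//; exact: measurableC.
Qed.

Lemma submeasures_density (a b : R) (mu : borel_measure R) :
  submeasures I gamma a b mu ->
  exists g, [/\ unit_fun g, has_density gamma I mu g, E g = a &
    E (fun y => (y : R) * g y) = b].
Proof.
move=> Nmu; have [muI _ _ mugamma] := Nmu.
have [g ug mug] := exists_density mI muI mugamma.
by exists g; have [] := (submeasuresP a b ug mug).1 Nmu.
Qed.

Lemma unit_fun_compl g : unit_fun g -> unit_fun (compl g).
Proof.
move=> [mg g01]; split; first exact: measurable_funB.
by move=> x; have /andP[g0 g1] := g01 x; rewrite subr_ge0 g1 gerBl.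
Qed.

Lemma Rintegral_compl f g : unit_fun g -> Int f ->
  E (fun y => f y * (1 - g y)) = E f - E (fun y => f y * g y).
Proof.
move=> ug intf; have intfg := integrableM_unit mI ug intf.
rewrite -RintegralB//; apply: eq_Rintegral => x _.
by rewrite mulrBr mulr1.
Qed.

Lemma Rintegral1_compl g : unit_fun g -> E (compl g) = fine (gamma I) - E g.
Proof.
move=> ug; rewrite RintegralB//; last exact: unit_fun_integrable.
  by rewrite Rintegral_cst// mul1r.
exact: finite_measure_integrable_cst.
Qed.

(** Being concentrated on [I], the measure [gamma] itself has density 1. *)
Lemma has_density_compl (mu nu : set T -> \bar R) g : unit_fun g ->
  has_density gamma I mu g ->
  measure_eq nu (fun B => gamma B - mu B)%E <-> has_density gamma I nu (compl g).
Proof.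
move=> ug mug.
have complE B : measurable B ->
    (gamma B - mu B = \int[gamma]_(x in B `&` I) (1 - g x)%:E)%E.
  move=> mB; have mBI : measurable (B `&` I) by exact: measurableI.
  rewrite mug// [RHS](integralB_EFin mBI); last 2 first.
  - exact: finite_measure_integrable_cst.
  - exact: unit_fun_integrable.
  rewrite integral_cst// mul1e; congr (_ - _)%E.
  rewrite (measureDI gamma mB mI) [X in (X + _)%E](_ : _ = 0%E) ?add0e//.
  apply: subset_measure0 gamma_I; [exact: measurableD|exact: measurableC|].
  by rewrite setDE; exact: subIsetr.
by split=> H B mB; rewrite H// complE.
Qed.

Lemma ae_eq_measure_eq (mu nu : borel_measure R) g h : unit_fun g -> unit_fun h ->
  has_density gamma I mu g -> has_density gamma I nu h ->
  ae_eq gamma I (EFin \o g) (EFin \o h) -> measure_eq mu nu.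
Proof. by move=> ug uh mug nuh /(ae_eq_density mI ug uh mug nuh). Qed.

(** The square root is at most [|y| + 1]. This admits the strictly concave test function used to
    prove uniqueness of the two parts. *)
Lemma integrable_sqrt1 : Int (fun y : T => - Num.sqrt (1 + (y : R) ^+ 2)).
Proof.
have int1 : Int (fun y : T => `|y : R| + 1).
  apply: (integrable_addr mI (integrable_norm gamma_moment)).
  exact: finite_measure_integrable_cst.
apply: (le_integrable mI _ _ int1).
  apply/measurable_EFinP/measurable_funTS.
  by apply: concave3_measurable => //; exact/strictly_concave3W/sqrt_strictly_concave3.
move=> x _ /=; rewrite lee_fin normrN ger0_norm ?sqrtr_ge0// ger0_norm ?addr_ge0//.
rewrite -[leRHS]ger0_norm ?addr_ge0// -sqrtr_sqr ler_wsqrtr//.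
rewrite sqrrD -normrX (ger0_norm (sqr_ge0 _)) expr1n mulr1 addrC lerD2r.
by rewrite lerDl mulrn_wge0.
Qed.

(** Complements subtract each integral from the one against [gamma]. Thus [1 - g] has the mass and
    moment of the connected density, and the optimality inequality for it reverses. *)
Lemma coconnected_density_optimal s t (g phi : T -> R) :
  is_interval (I : set R) -> open (I : set R) ->
  0 <= s -> s <= t -> t <= fine (gamma I) -> unit_fun g ->
  E (compl (connected_density I gamma s t)) = E g ->
  E (fun y => (y : R) * (1 - connected_density I gamma s t y)) =
    E (fun y => (y : R) * g y) ->
  Int phi -> concave3 I phi ->
  E (fun y => phi y * (1 - connected_density I gamma s t y)) <=
    E (fun y => phi y * g y) /\
  (strictly_concave3 I phi ->
   E (fun y => phi y * g y) =
     E (fun y => phi y * (1 - connected_density I gamma s t y)) ->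
   ae_eq gamma I (EFin \o g) (EFin \o compl (connected_density I gamma s t))).
Proof.
move=> itvI openI s0 st tm ug mass moment intphi cphi.
have uc := connected_density_unit itvI gamma st.
have ucg := unit_fun_compl ug.
rewrite (Rintegral1_compl uc) in mass; rewrite (Rintegral_compl uc)// in moment.
have mass' : E (connected_density I gamma s t) = E (compl g).
  by rewrite (Rintegral1_compl ug); lra.
have moment' : E (fun y => (y : R) * connected_density I gamma s t y) =
    E (fun y => (y : R) * (1 - g y)).
  by rewrite (Rintegral_compl ug)//; lra.
have [le_phi eq_phi] :=
  connected_density_optimal itvI openI gamma_moment s0 st tm ucg mass' moment'
    intphi cphi.
rewrite (Rintegral_compl ug)// in le_phi eq_phi.
rewrite (Rintegral_compl uc)//; split; first by lra.
move=> sphi Eeq; have : ae_eq gamma I (EFin \o compl g)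
    (EFin \o connected_density I gamma s t) by apply: eq_phi => //; lra.
by apply: filterS => x /[apply] /= -[<-]; rewrite subKr.
Qed.

End submeasure_densities.

(** * Attainment and uniqueness, carried from densities back to measures *)

Theorem proposition2p3 (R : realType) (I : set R)
    (I_itv : is_interval I) (I_open : open I) (I_neq0 : I !=set0)
    (gamma : {finite_measure set (measurableTypeR R) -> \bar R})
    (gamma_I : concentrated I gamma)
    (gamma_moment : gamma.-integrable (I : set (measurableTypeR R))
                      (fun y : measurableTypeR R => y%:E))
    (a b : R) (a_ge0 : 0 <= a) (a_le : (a%:E <= gamma I)%E)
    (b_ge : (first_moment I (quantile_restriction I gamma 0 a) <= b%:E)%E)
    (b_le : (b%:E <= first_moment I
       (quantile_restriction I gamma (fine (gamma I) - a) (fine (gamma I))))%E)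
    (phi : R -> R) (phi_concave : concave_function I phi)
    (phi_neg : (\int[gamma]_(y in (I : set (measurableTypeR R)))
                  (phi^\- y)%:E < +oo)%E) :
  let N : set (borel_measure R) := submeasures I gamma a b in
  let integral_phi (mu : borel_measure R) : \bar R :=
    (\int[mu]_(y in (I : set (measurableTypeR R))) (phi y)%:E)%E in
  exists kappa lambda : borel_measure R,
    [/\ unique_measure [set mu | N mu /\ connected_part I gamma mu] kappa /\
        integral_phi kappa = ereal_sup [set integral_phi mu | mu in N],
        unique_measure [set mu | N mu /\ coconnected_part I gamma mu] lambda /\
        integral_phi lambda = ereal_inf [set integral_phi mu | mu in N] &
        strictly_concave_function I phi ->
        (forall mu, N mu ->
           integral_phi mu = ereal_sup [set integral_phi nu | nu in N] ->
           measure_eq mu kappa) /\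
        (forall mu, N mu ->
           integral_phi mu = ereal_inf [set integral_phi nu | nu in N] ->
           measure_eq mu lambda)].
Proof.
have mI : measurable (I : set (measurableTypeR R)) by exact: is_interval_measurable.
move=> N J.
have cphi := concave_function3 phi_concave.
have intphi := concave_integrable I_itv I_open gamma_moment I_neq0 cphi phi_neg.
pose T := measurableTypeR R.
pose m := fine (gamma I).
pose E (f : T -> R) := Rintegral gamma I f.
pose c := connected_density I gamma.
pose d u v (y : T) := 1 - c u v y.
pose M := partial_moment I gamma.
have am : a <= m by rewrite -lee_fin fine_measureK.
have m0 : 0 <= m := le_trans a_ge0 am.
have uc s t : s <= t -> unit_fun (c s t) by exact: connected_density_unit.
have ud s t : s <= t -> unit_fun (d s t) by move=> st; exact/unit_fun_compl/uc.
have qr s t : 0 <= s -> s <= t ->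
    has_density gamma I (quantile_restriction I gamma s t) (c s t).
  exact: quantile_restriction_density.
have Ec s t : 0 <= s -> s <= t -> t <= m -> E (c s t) = t - s.
  move=> s0 st tm; rewrite /E /c RintegralB//;
    try exact: (unit_fun_integrable gamma mI (quantile_density_unit mI gamma _)).
  by rewrite !Rintegral_quantile_density_itv// ?(le_trans s0)//= ?s0 ?(le_trans st).
have Eyc s t : E (fun y => (y : R) * c s t y) = M t - M s.
  exact: moment_connected_density.
have M0 : M 0 = 0 by exact: partial_moment0.
have Mm : M m = E (fun y => y : R) by exact: partial_moment_full.
have b1 : M a - M 0 <= b.
  move: b_ge; rewrite /first_moment
    (integral_density_fin mI (uc _ _ a_ge0) (qr _ _ (lexx 0) a_ge0) gamma_moment).
  by rewrite lee_fin -Eyc.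
have ma0 : 0 <= m - a by rewrite subr_ge0.
have mam : m - a <= m by rewrite gerBl.
have b2 : b <= M m - M (m - a).
  move: b_le; rewrite /first_moment
    (integral_density_fin mI (uc _ _ mam) (qr _ _ ma0 mam) gamma_moment).
  by rewrite lee_fin -Eyc.
have am' : 0 <= a <= m by rewrite a_ge0.
have [s [s0 sam sb]] := connected_density_exists I_itv gamma_moment am' b1 b2.
have ssa : s <= s + a by rewrite lerDl.
(* The connected part to be removed from [gamma] must have the complementary mass [m - a] and moment
   [M m - b]; the bounds on [b] exchange roles. *)
have [s' [s0' sam' sb']] : exists s', [/\ 0 <= s', s' + (m - a) <= m &
    M (s' + (m - a)) - M s' = M m - b].
  apply: (connected_density_exists I_itv gamma_moment); rewrite -/m.
  - by rewrite ma0.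
  - by rewrite -/M; lra.
  - by rewrite -/M opprB addrCA subrr addr0; lra.
have ssa' : s' <= s' + (m - a) by rewrite lerDl.
pose kappa := quantile_restriction I gamma s (s + a).
have kappaD : has_density gamma I kappa (c s (s + a)) by exact: qr.
(* A difference of measures is only a set function, so the co-connected part is built from its
   density. *)
have [lambda lambdaD] := exists_density_measure gamma mI (ud _ _ ssa').
pose D g := E g = a /\ E (fun y => (y : R) * g y) = b.
have NP (mu : borel_measure R) g : unit_fun g -> has_density gamma I mu g ->
    N mu <-> D g.
  by move=> ug mug; exact: submeasuresP.
have Dkappa : D (c s (s + a)) by split; [rewrite Ec//; lra|rewrite Eyc].
have Dlambda : D (d s' (s' + (m - a))).
  split.
    rewrite [LHS](Rintegral1_compl mI gamma (uc _ _ ssa')).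
    have Es' := Ec _ _ s0' ssa' sam'; rewrite /E in Es'.
    by rewrite Es' -/m; lra.
  rewrite [LHS](Rintegral_compl mI (uc _ _ ssa') gamma_moment).
  have Eys' := Eyc s' (s' + (m - a)); rewrite /E in Eys' Mm.
  by rewrite Eys' -Mm; lra.
have opt u v f (g : T -> R) : unit_fun g -> D g -> D (c u v) ->
    0 <= u -> u <= v -> v <= m ->
    gamma.-integrable I (EFin \o f) -> concave3 I f ->
    E (fun y => f y * g y) <= E (fun y => f y * c u v y) /\
    (strictly_concave3 I f -> E (fun y => f y * g y) = E (fun y => f y * c u v y) ->
     ae_eq gamma I (EFin \o g) (EFin \o c u v)).
  move=> ug [Eg Eyg] [Ecuv Eycuv] u0 uv vm intf cf.
  apply: connected_density_optimal => //; first by rewrite [LHS]Ecuv.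
  by rewrite [LHS]Eycuv.
have copt u v f (g : T -> R) : unit_fun g -> D g -> D (d u v) ->
    0 <= u -> u <= v -> v <= m ->
    gamma.-integrable I (EFin \o f) -> concave3 I f ->
    E (fun y => f y * d u v y) <= E (fun y => f y * g y) /\
    (strictly_concave3 I f -> E (fun y => f y * g y) = E (fun y => f y * d u v y) ->
     ae_eq gamma I (EFin \o g) (EFin \o d u v)).
  move=> ug [Eg Eyg] [Eduv Eyduv] u0 uv vm intf cf.
  apply: coconnected_density_optimal => //; first by rewrite [LHS]Eduv.
  by rewrite [LHS]Eyduv.
have JE (mu : borel_measure R) g : unit_fun g -> has_density gamma I mu g ->
    J mu = (E (fun y => phi y * g y))%:E.
  by move=> ug mug; exact: integral_density_fin.
have Nkappa : N kappa by apply/(NP _ _ (uc _ _ ssa) kappaD).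
have Nlambda : N lambda by apply/(NP _ _ (ud _ _ ssa') lambdaD).
have Jkappa : J kappa = ereal_sup [set J mu | mu in N].
  apply/eqP; rewrite eq_le; apply/andP; split.
    by apply: ereal_sup_ubound; exists kappa.
  apply: ge_ereal_sup => _ [mu Nmu <-].
  have [g [ug mug Eg Eyg]] := submeasures_density mI gamma_moment Nmu.
  rewrite (JE _ _ ug mug) (JE _ _ (uc _ _ ssa) kappaD) lee_fin.
  by have [] := opt s (s + a) phi g ug (conj Eg Eyg) Dkappa s0 ssa sam intphi cphi.
have Jlambda : J lambda = ereal_inf [set J mu | mu in N].
  apply/eqP; rewrite eq_le; apply/andP; split; last first.
    by apply: ereal_inf_lbound; exists lambda.
  apply: le_ereal_inf_tmp => _ [mu Nmu <-].
  have [g [ug mug Eg Eyg]] := submeasures_density mI gamma_moment Nmu.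
  rewrite (JE _ _ ug mug) (JE _ _ (ud _ _ ssa') lambdaD) lee_fin.
  by have [] := copt s' _ phi g ug (conj Eg Eyg) Dlambda s0' ssa' sam' intphi cphi.
(* Uniqueness of the two parts is claimed for every concave [phi], so it is tested on a fixed
   strictly concave integrable function. *)
pose phi0 (y : T) : R := - Num.sqrt (1 + (y : R) ^+ 2).
have sphi0 : strictly_concave3 I phi0 by exact: sqrt_strictly_concave3.
have cphi0 := strictly_concave3W sphi0.
have intphi0 : gamma.-integrable I (EFin \o phi0) by exact: integrable_sqrt1.
exists kappa, lambda; split.
- split=> //; split.
    split=> //; exists s, (s + a); split=> //.
    by rewrite -(fine_measureK gamma mI) lee_fin.
  move=> nu [Nnu [u [v [u0 uv vm nuq]]]].
  have {}vm : v <= m by rewrite -lee_fin fine_measureK.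
  have nuD : has_density gamma I nu (c u v) by move=> B mB; rewrite nuq// qr.
  have Dnu := (NP _ _ (uc _ _ uv) nuD).1 Nnu.
  (* Both densities are connected and feasible, so each is optimal against the other for [phi0];
     their integrals agree, and the equality case identifies them. *)
  have [le1 eq1] := opt s _ phi0 _ (uc _ _ uv) Dnu Dkappa s0 ssa sam intphi0 cphi0.
  have [le2 _] := opt u v phi0 _ (uc _ _ ssa) Dkappa Dnu u0 uv vm intphi0 cphi0.
  apply: (ae_eq_measure_eq mI (uc _ _ uv) (uc _ _ ssa) nuD kappaD).
  by apply: eq1 => //; apply/eqP; rewrite eq_le le1 le2.
- split=> //; split.
    split=> //; exists s', (s' + (m - a)); split=> //.
      by rewrite -(fine_measureK gamma mI) lee_fin.
    exact/(has_density_compl mI gamma_I _ (uc _ _ ssa') (qr _ _ s0' ssa')).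
  move=> nu [Nnu [u [v [u0 uv vm nuq]]]].
  have {}vm : v <= m by rewrite -lee_fin fine_measureK.
  have nuD : has_density gamma I nu (d u v).
    exact/(has_density_compl mI gamma_I _ (uc _ _ uv) (qr _ _ u0 uv)).
  have Dnu := (NP _ _ (ud _ _ uv) nuD).1 Nnu.
  have [le1 eq1] := copt s' _ phi0 _ (ud _ _ uv) Dnu Dlambda s0' ssa' sam' intphi0 cphi0.
  have [le2 _] := copt u v phi0 _ (ud _ _ ssa') Dlambda Dnu u0 uv vm intphi0 cphi0.
  apply: (ae_eq_measure_eq mI (ud _ _ uv) (ud _ _ ssa') nuD lambdaD).
  by apply: eq1 => //; apply/eqP; rewrite eq_le le1 le2.
move=> /strictly_concave_function3 sphi; split=> mu Nmu.
  rewrite -Jkappa; have [g [ug mug Eg Eyg]] := submeasures_density mI gamma_moment Nmu.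
  rewrite (JE _ _ ug mug) (JE _ _ (uc _ _ ssa) kappaD) => -[Eeq].
  apply: (ae_eq_measure_eq mI ug (uc _ _ ssa) mug kappaD).
  have [_ eq1] := opt s _ phi g ug (conj Eg Eyg) Dkappa s0 ssa sam intphi cphi.
  exact: eq1.
rewrite -Jlambda; have [g [ug mug Eg Eyg]] := submeasures_density mI gamma_moment Nmu.
rewrite (JE _ _ ug mug) (JE _ _ (ud _ _ ssa') lambdaD) => -[Eeq].
apply: (ae_eq_measure_eq mI ug (ud _ _ ssa') mug lambdaD).
have [_ eq1] := copt s' _ phi g ug (conj Eg Eyg) Dlambda s0' ssa' sam' intphi cphi.
exact: eq1.
Qed.
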